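(* Let $\mathbb{K}$ be a field, let $G$ be a graph with vertex set $\{v_1,\dots,v_n\}$, let $S=\mathbb{K}[x_1,\dots,x_n]$, and let $I=I(G)\subseteq S$ be the edge ideal of $G$. Then $\overline{I^k}/\overline{I^{k+1}}$ satisfies Stanley's inequality for every integer $k\gg 0$; that is, there is $k_0$ such that ${\rm depth}(\overline{I^k}/\overline{I^{k+1}})\leq{\rm sdepth}(\overline{I^k}/\overline{I^{k+1}})$ for all $k\geq k_0$.
   Context: Graphs are finite and simple. The edge ideal of $G$ is $I(G)=(x_ix_j : \{v_i,v_j\}\in E(G))\subseteq S$. For an ideal $J\subseteq S$, $\overline{J}$ denotes its integral closure; if $J$ is a monomial ideal, $\overline{J}$ is the monomial ideal generated by all monomials $u\in S$ such that $u^r\in J^r$ for some integer $r\geq 1$. Stanley depth: let $M$ be a finitely generated $\mathbb{Z}^n$-graded $S$-module. For a homogeneous $u\in M$ and $Z\subseteq\{x_1,\dots,x_n\}$, the $\mathbb{K}$-subspace $u\mathbb{K}[Z]$ of $M$ generated by all $uv$ with $v$ a monomial in $\mathbb{K}[Z]$ is called a Stanley space of dimension $|Z|$ if it is a free $\mathbb{K}[Z]$-module. A Stanley decomposition $\mathcal{D}$ of $M$ is a decomposition of $M$ (as a $\mathbb{K}$-vector space) as a finite direct sum of Stanley spaces; ${\rm sdepth}(\mathcal{D})$ is the minimum dimension of a Stanley space in $\mathcal{D}$, and ${\rm sdepth}(M)$ is the maximum of ${\rm sdepth}(\mathcal{D})$ over all Stanley decompositions $\mathcal{D}$ of $M$.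 By convention ${\rm sdepth}(0)=\infty$ (so the zero module satisfies Stanley's inequality). *)

(* Defs.v *)
From mathcomp Require Export all_boot all_order all_algebra.
From mathcomp Require Export boolp classical_sets.
From mathcomp Require Export mpoly.

Set Implicit Arguments.
Unset Strict Implicit.
Unset Printing Implicit Defensive.

Import GRing.Theory.
Local Open Scope ring_scope.
Local Open Scope classical_set_scope.

(* Extended natural numbers: [None] is infinity. *)
Definition enat := option nat.

Definition enat_le (a b : enat) : bool :=
  match a, b with
  | _, None => true
  | None, Some _ => false
  | Some p, Some q => (p <= q)%N
  end.

Definition enat_min (a b : enat) : enat := if enat_le a b then a else b.

Definition enat_is_lub (A : set enat) (s : enat) : Prop :=
  (forall a, A a -> enat_le a s) /\
  (forall t, (forall a, A a -> enat_le a t) -> enat_le s t).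

(* The supremum of the empty set is 0. *)
Definition enat_sup (A : set enat) : enat := xget None [set s | enat_is_lub A s].

Lemma enat_supP (A : set enat) : enat_is_lub A (enat_sup A).
Proof.
suff [s hs] : exists s, enat_is_lub A s.
  by rewrite /enat_sup; case: xgetP => [t _ //|/(_ s)].
have [[b hb]|nb] := pselect (exists b : nat, forall a, A a -> enat_le a (Some b)).
  pose P (b : nat) := `[< forall a, A a -> enat_le a (Some b) >].
  have exP : exists b, P b by exists b; apply/asboolP.
  case: (ex_minnP exP) => m /asboolP hm mmin.
  exists (Some m); split=> // -[t|] // ht /=.
  by apply: mmin; apply/asboolP.
exists None; split=> [[a|] //|[t|] // ht].
by case: nb; exists t.
Qed.

(* Ideals of K[x_1, ..., x_n] as sets of polynomials. *)
Section Ideals.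
Variables (K : fieldType) (n : nat).
Local Notation S := {mpoly K[n]}.
Implicit Types (A J L : set S).

Definition ideal_gen A : set S :=
  [set f | exists s : seq (S * S),
     (forall p, p \in s -> A p.2) /\ f = \sum_(p <- s) p.1 * p.2].

Definition ideal_add J L : set S :=
  [set f | exists g h, [/\ J g, L h & f = g + h]].

Definition ideal_mul J L : set S :=
  ideal_gen [set f | exists g h, [/\ J g, L h & f = g * h]].

Fixpoint ideal_pow J (k : nat) : set S :=
  if k is k'.+1 then ideal_mul J (ideal_pow J k') else setT.

(* f ^ d + a_1 f ^ (d - 1) + ... + a_d = 0 with a_i in J ^ i. *)
Definition integral_closure J : set S :=
  [set f | exists d : nat, exists a : nat -> S,
     [/\ (0 < d)%N,
         forall i, (1 <= i <= d)%N -> ideal_pow J i (a i) &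
         f ^+ d + \sum_(1 <= i < d.+1) a i * f ^+ (d - i) = 0]].

(* The ideal (x_1, ..., x_n). *)
Definition irrelevant_ideal : set S := ideal_gen [set f | exists i, f = 'X_i].

Definition edge_ideal (e : rel 'I_n) : set S :=
  ideal_gen [set f | exists i j, e i j /\ f = 'X_i * 'X_j].

End Ideals.

Arguments edge_ideal K {n} e.

(* Below, ideals L `<=` J represent the module M = J / L: an element of M is
   given by an element of J, two of them being equal in M when their difference
   is in L. *)
Section Subquotients.
Variables (K : fieldType) (n : nat).
Local Notation S := {mpoly K[n]}.
Implicit Types (J L : set S) (Z : {set 'I_n}).

(* M / (fs) M is J / (L + (fs) J). *)
Definition seq_submodule J L (fs : seq S) : set S :=
  ideal_add L (ideal_mul (ideal_gen [set f | f \in fs]) J).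

Definition regular_sequence J L (fs : seq S) : Prop :=
  (forall i, (i < size fs)%N -> forall g, J g ->
     seq_submodule J L (take i fs) (nth 0 fs i * g) ->
     seq_submodule J L (take i fs) g) /\
  ~ (J `<=` seq_submodule J L fs).

(* Supremum of the lengths of M-regular sequences in (x_1, ..., x_n), with the
   usual convention that the zero module has infinite depth. *)
Definition depth J L : enat :=
  if `[< J `<=` L >] then None
  else enat_sup [set d | exists fs : seq S,
    [/\ forall f, f \in fs -> irrelevant_ideal f,
        regular_sequence J L fs & d = Some (size fs)]].

(* The subring K[Z]. *)
Definition poly_in Z : set S :=
  [set p | forall m, m \in msupp p -> forall i, m i != 0%N -> i \in Z].

(* For monomial ideals J and L, the Z^n-graded component of M of degree a
   consists of the classes of the c x^a in J. *)
Definition homogeneous J (u : S) : Prop :=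
  J u /\ exists (c : K) (a : 'X_{1.. n}), u = c *: 'X_[a].

(* u K[Z] is free over K[Z] on the generator u. *)
Definition stanley_space J L (u : S) Z : Prop :=
  homogeneous J u /\ (forall p, poly_in Z p -> L (u * p) -> p = 0).

(* M is the direct sum of the K-subspaces u_i K[Z_i], each of which consists of
   the classes of the u_i p with p in K[Z_i]. *)
Definition stanley_decomposition J L (r : nat) (u : 'I_r -> S)
    (Z : 'I_r -> {set 'I_n}) : Prop :=
  [/\ forall i, stanley_space J L (u i) (Z i),
      forall f, J f -> exists p : 'I_r -> S,
        (forall i, poly_in (Z i) (p i)) /\ L (f - \sum_i u i * p i) &
      forall p : 'I_r -> S, (forall i, poly_in (Z i) (p i)) ->
        L (\sum_i u i * p i) -> forall i, L (u i * p i)].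

(* Infinite for the empty decomposition, which only the zero module has. *)
Definition decomposition_sdepth (r : nat) (Z : 'I_r -> {set 'I_n}) : enat :=
  \big[enat_min/None]_(i < r) Some #|Z i|.

Definition sdepth J L : enat :=
  enat_sup [set d | exists r (u : 'I_r -> S) (Z : 'I_r -> {set 'I_n}),
    stanley_decomposition J L u Z /\ d = decomposition_sdepth Z].

Definition stanley_inequality J L : Prop := enat_le (depth J L) (sdepth J L).

End Subquotients.

(* Main.v *)
Require Import Defs.
From HB Require Import structures.
From mathcomp Require Import ring zify.

(** Write [P_k] for the set of exponents [m] with [2 k <= wt w m] for every double
    cover [w], a function on the vertices with [w i + w j >= 2] on all edges.
    Monomial valuations show that every monomial of an element integral over
    [I ^ k] has its exponent in [P_k]; Koenig's theorem in the bipartite double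
    cover of the graph shows conversely that the square of a monomial with
    exponent in [P_k] lies in [I ^ (2 k)].  Since the elements integral over an
    ideal form an ideal, the integral closure of [I ^ k] is spanned by the
    monomials with exponents in [P_k] ([integral_closure_edge_pow]).

    Without edges the module vanishes for [k > 0].  Otherwise let [p] be the
    number of bipartite components, isolated vertices included.  For [k] large
    the depth of the module is at most [p], and for all [k] its Stanley depth is
    at least [p].

    Depth ([depth_le_bip]).  A regular sequence of length [d] forces the Koszul
    cohomology of the module to vanish in degrees less than [d]
    ([regular_sequence_vanishing]), so a nonzero class in degree [p] suffices.
    Take a monomial [u] deep inside the cone spanned by the edges, of degree
    [2 k] or [2 k + 1].  Multiplying [u] by a vertex of a component that is not
    bipartite, or by two vertices from opposite sides of a bipartite component,
    leads into the integral closure of [I ^ (k + 1)], whereas vertices from one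
    side of each bipartite component do not.  If there are no isolated vertices,
    the module is therefore governed near [u] by the join of [p] copies of two
    disjoint simplices, a sphere of dimension [p - 1] up to homotopy, and this
    carries a class of degree [p].  The class is a product of one form for each
    component; it is detected by the alternating sum of its coefficients over
    the facets of a cross-polytope inscribed in the sphere.  An isolated vertex
    contributes one more factor, the top class of its polynomial ring.

    Stanley depth ([sdepth_ge_bip]).  Let [m] be an exponent.  In each bipartite
    component some vertex is free: its exponent can be raised without changing
    the least weight of a cover on this component, because a lightest cover can
    be chosen to vanish somewhere on the component.  The least free vertex of a
    component stays the least free vertex when its exponent is raised.  Hence
    moving along these vertices partitions the exponents of the module into
    cones of dimension at least [p], and since the module only depends on the
    exponents truncated at [2 k + 2], finitely many cones suffice. *)

Set Implicit Arguments.
Unset Strict Implicit.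
Unset Printing Implicit Defensive.

Import GRing.Theory.
Local Open Scope ring_scope.
Local Open Scope classical_set_scope.

(** * Exterior multiplication on cochains *)

Section Wedge.
Variables (R : comNzRingType) (T : finType).
Implicit Types (lam mu x g : T -> R) (c : seq T -> R) (P : set R).

Definition is_ideal P : Prop :=
  [/\ P 0, forall a b, P a -> P b -> P (a + b) & forall a b, P b -> P (a * b)].

Lemma ideal0 P : is_ideal P -> P 0. Proof. by case. Qed.

Lemma idealD P a b : is_ideal P -> P a -> P b -> P (a + b).
Proof. by case=> _ + _; exact. Qed.

Lemma idealM P a b : is_ideal P -> P b -> P (a * b).
Proof. by case=> _ _; exact. Qed.

Lemma idealN P a : is_ideal P -> P a -> P (- a).
Proof. by move=> hP ha; rewrite -mulN1r; exact: idealM. Qed.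

Lemma idealB P a b : is_ideal P -> P a -> P b -> P (a - b).
Proof. by move=> hP ha hb; apply: idealD => //; exact: idealN. Qed.

Lemma ideal_sum P (I : eqType) (r : seq I) (Q : pred I) (F : I -> R) :
  is_ideal P -> (forall i, i \in r -> Q i -> P (F i)) -> P (\sum_(i <- r | Q i) F i).
Proof.
move=> hP hF; rewrite big_seq_cond; apply: big_ind => [|a b|i /andP[ir Qi]].
- exact: ideal0.
- exact: idealD.
- exact: hF.
Qed.

Lemma ideal_colon P a : is_ideal P -> is_ideal [set b | P (b * a)].
Proof.
move=> hP; split=> [|b c /= hb hc|b c /= hc]; rewrite /= ?mul0r ?mulrDl -?mulrA.
- exact: ideal0.
- exact: idealD.
- exact: idealM.
Qed.

(** A cochain is an arbitrary function on sequences of indices, not an alternating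
    one: left multiplication by a 1-form on the tensor algebra then has this
    recursive description without signs of permutations, and the identities of
    the Koszul complex follow by induction on the sequence.  The differential
    of the complex is [wedge x] for the 1-form [x] of the variables. *)
Fixpoint wedge lam c (s : seq T) {struct s} : R :=
  if s is j :: s' then lam j * c s' - wedge lam (fun t => c (j :: t)) s' else 0.

Lemma wedgeB lam c c' s :
  wedge lam (fun t => c t - c' t) s = wedge lam c s - wedge lam c' s.
Proof.
elim: s c c' => [|j s IH] c c' /=; first by rewrite subr0.
by rewrite IH; ring.
Qed.

Lemma wedgeZ lam a c s : wedge lam (fun t => a * c t) s = a * wedge lam c s.
Proof.
elim: s c => [|j s IH] c /=; first by rewrite mulr0.
by rewrite IH; ring.
Qed.

Lemma wedge_lin lam mu a c s :
  wedge (fun j => a * lam j + mu j) c s = a * wedge lam c s + wedge mu c s.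
Proof.
elim: s c => [|j s IH] c /=; first by rewrite mulr0 addr0.
by rewrite IH; ring.
Qed.

Lemma wedge_anticomm lam mu c s :
  wedge lam (wedge mu c) s = - wedge mu (wedge lam c) s.
Proof.
elim: s c => [|j s IH] c /=; first by rewrite oppr0.
by rewrite !wedgeB !wedgeZ IH; ring.
Qed.

Lemma wedge_sq lam c s : wedge lam (wedge lam c) s = 0.
Proof.
elim: s c => [//|j s IH] c /=.
by rewrite wedgeB wedgeZ IH; ring.
Qed.

Lemma wedge0 lam c s : (forall t, c t = 0) -> wedge lam c s = 0.
Proof.
elim: s c => [//|j s IH] c c0 /=.
by rewrite c0 IH // mulr0 subr0.
Qed.

Lemma wedge_mem P lam c s : is_ideal P ->
  (forall j t, P (lam j * c t)) -> P (wedge lam c s).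
Proof.
move=> hP; elim: s c => [|j s IH] c hc /=; first exact: ideal0.
by apply: idealB => //; apply: IH => i t; exact: hc.
Qed.

(** Cochains are defined in all degrees at once, but membership is often known in
    a single degree only. *)
Lemma wedge_mem_deg P lam c k : is_ideal P ->
  (forall s, size s = k -> P (c s)) ->
  forall s, size s = k.+1 -> P (wedge lam c s).
Proof.
move=> hP hc s; elim: s k c hc => [//|j s IH] k c hc /= [sk].
apply: idealB => //; first by apply: idealM => //; exact: hc.
case: s IH sk => [|i s] IH sk; first exact: ideal0.
rewrite -sk in hc; apply: (IH (size s)) => // t ts; apply: hc => /=.
by rewrite ts.
Qed.

Definition contraction g c (s : seq T) : R := \sum_j g j * c (j :: s).

Lemma wedge_suml lam g (F : T -> seq T -> R) s :
  wedge lam (fun t => \sum_j g j * F j t) s = \sum_j g j * wedge lam (F j) s.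
Proof.
elim: s F => [|i s IH] F /=; first by rewrite big1 // => j _; rewrite mulr0.
rewrite (IH (fun j t => F j (i :: t))) mulr_sumr -sumrB.
by apply: eq_bigr => j _; ring.
Qed.

(** Contracting with [g] is a homotopy between zero and the multiplication by
    [\sum_j g j * x j]: every element of the ideal generated by the [x j]
    annihilates the cohomology of the complex with differential [wedge x]. *)
Lemma contraction_homotopy g x c s :
  contraction g (wedge x c) s + wedge x (contraction g c) s =
  (\sum_j g j * x j) * c s.
Proof.
rewrite /contraction wedge_suml -big_split mulr_suml /=.
by apply: eq_bigr => j _; ring.
Qed.

End Wedge.

(** * Regular sequences and the vanishing of cohomology *)

Section RegularSequences.
Variables (K : fieldType) (n : nat).
Local Notation S := {mpoly K[n]}.
Implicit Types (J L : set S) (c z w : seq 'I_n -> S) (fs : seq S).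

Definition xform (j : 'I_n) : S := 'X_j.

Lemma ideal_gen_ideal (A : set S) : is_ideal (ideal_gen A).
Proof.
split=> [|_ _ [s [sA ->]] [t [tA ->]]|a _ [s [sA ->]]].
- by exists [::]; rewrite big_nil.
- exists (s ++ t); rewrite big_cat; split=> // p.
  by rewrite mem_cat => /orP[/sA|/tA].
- exists [seq (a * p.1, p.2) | p <- s]; split=> [p /mapP[q qs ->]|].
    exact: (sA q qs).
  by rewrite big_map mulr_sumr; apply: eq_bigr => p _; rewrite mulrA.
Qed.

Lemma ideal_gen_sub (A P : set S) : is_ideal P -> A `<=` P -> ideal_gen A `<=` P.
Proof.
move=> hP AP _ [s [sA ->]]; apply: ideal_sum => // p ps _.
by apply: idealM => //; apply: AP; exact: sA.
Qed.

Lemma ideal_gen_mem (A : set S) f : A f -> ideal_gen A f.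
Proof.
move=> Af; exists [:: (1, f)]; rewrite big_seq1 mul1r; split=> // p.
by rewrite inE => /eqP->.
Qed.

Lemma ideal_add_ideal J L : is_ideal J -> is_ideal L -> is_ideal (ideal_add J L).
Proof.
move=> hJ hL; split.
- by exists 0, 0; split; [exact: ideal0|exact: ideal0|rewrite addr0].
- move=> _ _ [a [b [Ja Lb ->]]] [c [d [Jc Ld ->]]].
  exists (a + c), (b + d); split; [exact: idealD|exact: idealD|].
  by rewrite addrACA.
- move=> f _ [a [b [Ja Lb ->]]]; exists (f * a), (f * b).
  by split; [exact: idealM|exact: idealM|rewrite mulrDr].
Qed.

Lemma seq_submodule_ideal J L fs : is_ideal L -> is_ideal (seq_submodule J L fs).
Proof. by move=> hL; apply: ideal_add_ideal => //; exact: ideal_gen_ideal. Qed.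

Lemma seq_submodule_nil J L f : is_ideal L -> seq_submodule J L [::] f -> L f.
Proof.
move=> hL [l [h [Ll hh ->]]]; apply: idealD => //.
apply: (ideal_gen_sub _ _ hh) => // _ [g [h' [gg _ ->]]].
suff -> : g = 0 by rewrite mul0r; exact: ideal0.
apply: (ideal_gen_sub (P := [set x | x = 0]) _ _ gg) => //.
split=> //= [a b -> ->|a b ->]; [by rewrite addr0|by rewrite mulr0].
Qed.

Lemma sub_seq_submodule J L fs f : L f -> seq_submodule J L fs f.
Proof.
by move=> Lf; exists f, 0; split=> //; [exact: ideal0 (ideal_gen_ideal _)|rewrite addr0].
Qed.

Lemma seq_submodule_mul J L fs f g :
  is_ideal L -> f \in fs -> J g -> seq_submodule J L fs (f * g).
Proof.
move=> hL ffs Jg; exists 0, (f * g); split; [exact: ideal0| |by rewrite add0r].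
by apply: ideal_gen_mem; exists f, g; split=> //; exact: ideal_gen_mem.
Qed.

Lemma seq_submodule_sub J L fs (P : set S) : is_ideal P -> L `<=` P ->
  (forall f g, f \in fs -> J g -> P (f * g)) -> seq_submodule J L fs `<=` P.
Proof.
move=> hP LP hfs _ [l [h [Ll hh ->]]]; apply: idealD => //; first exact: LP.
apply: (ideal_gen_sub _ _ hh) => // _ [g [h' [gg Jh' ->]]].
apply: (ideal_gen_sub (P := [set x | P (x * h')]) _ _ gg).
  exact: ideal_colon.
by move=> f ffs; exact: hfs.
Qed.

(** Dividing by one more element of a sequence adds the multiples of this element
    by [J], so that the sequence can be treated one element at a time. *)
Lemma seq_submodule_rcons J L fs f g : is_ideal J -> is_ideal L ->
  seq_submodule J L (rcons fs f) g ->
  exists l h, [/\ seq_submodule J L fs l, J h & g = l + f * h].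
Proof.
move=> hJ hL; pose P := [set g | exists l h,
  [/\ seq_submodule J L fs l, J h & g = l + f * h]].
have hS := seq_submodule_ideal J fs hL.
apply: (@seq_submodule_sub _ _ _ P); rewrite {}/P.
- split.
  + by exists 0, 0; split; [exact: ideal0|exact: ideal0|ring].
  + move=> _ _ [a [b [Ja Lb ->]]] [c [d [Jc Ld ->]]].
    by exists (a + c), (b + d); split; [exact: idealD|exact: idealD|ring].
  + move=> x _ [a [b [Ja Lb ->]]]; exists (x * a), (x * b).
    by split; [exact: idealM|exact: idealM|ring].
- move=> l Ll; exists l, 0.
  by split; [exact: sub_seq_submodule|exact: ideal0|ring].
- move=> x h; rewrite mem_rcons inE => /orP[/eqP->|xfs] Jh.
    by exists 0, h; split=> //; [exact: ideal0|ring].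
  by exists (x * h), 0; split; [exact: seq_submodule_mul|exact: ideal0|ring].
Qed.

Lemma irrelevant_idealP f :
  irrelevant_ideal f -> exists g : 'I_n -> S, f = \sum_j g j * xform j.
Proof.
apply: (@ideal_gen_sub _ [set f | exists g : 'I_n -> S, f = \sum_j g j * xform j]).
  split.
  - by exists (fun=> 0); rewrite big1 // => j _; rewrite mul0r.
  - move=> _ _ [g ->] [h ->]; exists (fun j => g j + h j).
    by rewrite -big_split; apply: eq_bigr => j _ /=; ring.
  - move=> a _ [g ->]; exists (fun j => a * g j).
    by rewrite mulr_sumr; apply: eq_bigr => j _; ring.
move=> _ [i ->]; exists (fun j => (j == i)%:R).
rewrite (bigD1 i) //= eqxx mul1r big1 ?addr0 // => j /negPf->.
by rewrite mul0r.
Qed.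

(** Depth sensitivity: the cohomology of [J / L] vanishes in the degrees below
    the length of a regular sequence [fs].  If [f] is the next element of [fs],
    then [f] kills the class of a cocycle [z], so that [f z] is the coboundary
    of some [w].  This [w] is a cocycle for the quotient by [f], hence it is
    cohomologous to a multiple [f w'] there, and cancelling [f] exhibits [z] as
    the coboundary of [w']. *)
Lemma regular_sequence_vanishing J L fs i z :
  is_ideal J -> is_ideal L ->
  (forall f, f \in fs -> irrelevant_ideal f) -> regular_sequence J L fs ->
  (i < size fs)%N ->
  (forall s, size s = i -> J (z s)) ->
  (forall s, size s = i.+1 -> L (wedge xform z s)) ->
  exists w, forall s, size s = i -> L (z s - wedge xform w s).
Proof.
move=> hJ hL irr [reg _] ifs Jz Lz.
pose M t := seq_submodule J L (take t fs).
have hM t : is_ideal (M t) by exact: seq_submodule_ideal.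
suff H : forall i t z, (t + i < size fs)%N ->
    (forall s, size s = i -> J (z s)) ->
    (forall s, size s = i.+1 -> M t (wedge xform z s)) ->
    exists w, (forall s, (size s).+1 = i -> J (w s)) /\
      forall s, size s = i -> M t (z s - wedge xform w s).
  have [w [_ hw]] := H i 0%N z ifs Jz (fun s hs => sub_seq_submodule _ _ (Lz s hs)).
  exists w => s hs; apply: (@seq_submodule_nil J) => //.
  by move: (hw s hs); rewrite /M take0.
move=> {i z ifs Jz Lz}; elim=> [|i IH] t z ti Jz Mz.
all: have tfs : (t < size fs)%N by lia.
all: set f := nth 0 fs t.
all: have [g fE] := irrelevant_idealP (irr _ (mem_nth 0 tfs)).
all: have homot s := contraction_homotopy g xform z s.
all: rewrite -fE -/f in homot.
all: have cM s k : size s = k -> 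
       (forall s, size s = k.+1 -> M t (wedge xform z s)) ->
       M t (contraction g (wedge xform z) s).
all: try by move=> sk h; apply: ideal_sum => // j _ _; apply: idealM => //;
       apply: h => /=; rewrite sk.
  exists (fun=> 0); split=> // s s0.
  rewrite wedge0 // subr0; apply: reg => //; first exact: Jz.
  have := cM s 0%N s0 Mz; have := homot s.
  by case: s s0 => // _ /=; rewrite addr0 => ->.
(* The homotopy makes [f z] the coboundary of [y] modulo [M t]. *)
pose y := contraction g z.
have Jy s : size s = i -> J (y s).
  move=> si; apply: ideal_sum => // j _ _; apply: idealM => //; apply: Jz.
  by rewrite /= si.
have yz s : size s = i.+1 -> M t (f * z s - wedge xform y s).
  by move=> si; rewrite -homot addrK; exact: (cM s i.+1).
have fM h : J h -> M t.+1 (f * h).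
  move=> Jh; apply: seq_submodule_mul => //.
  by rewrite (take_nth 0) // mem_rcons mem_head.
have MS : M t `<=` M t.+1.
  apply: seq_submodule_sub => // [l Ll|x h xt Jh]; first exact: sub_seq_submodule.
  apply: seq_submodule_mul => //.
  by rewrite (take_nth 0) // mem_rcons inE xt orbT.
have [||w [Jw hw]] := IH t.+1 y _ Jy.
- by lia.
- move=> s si.
  have -> : wedge xform y s = f * z s - (f * z s - wedge xform y s) by ring.
  by apply: idealB => //; [apply: fM; exact: Jz|apply: MS; exact: yz].
(* Modulo [M t.+1] the cocycle [y] is the coboundary of [w]; the difference is a
   multiple [f v] modulo [M t]. *)
have [s|v hv] := @choice _ _ (fun s v => size s = i ->
    J v /\ M t (y s - wedge xform w s - f * v)).
  have [si|nsi] := pselect (size s = i); last by exists 0.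
  have := hw s si; rewrite /M (take_nth 0) //.
  move=> /(seq_submodule_rcons hJ hL)[l [h [Ml Jh E]]].
  by exists h => _; split=> //; rewrite E addrK.
exists v; split=> [s [si]|s si]; first by case: (hv s si).
have Jdv : J (wedge xform v s) by apply: (@wedge_mem_deg _ _ _ _ _ i) => // t0 /hv[].
apply: reg => //; first exact: idealB (Jz _ si) Jdv.
have Mdv : M t (wedge xform y s - f * wedge xform v s).
  have := @wedge_mem_deg _ _ _ xform (fun s => y s - wedge xform w s - f * v s) i (hM t).
  move=> /(_ (fun s si => (hv s si).2) s si).
  by rewrite !wedgeB wedgeZ wedge_sq subr0.
have -> : nth 0 fs t * (z s - wedge xform v s) =
  (f * z s - wedge xform y s) + (wedge xform y s - f * wedge xform v s).
  by rewrite -/f; ring.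
exact: (idealD (hM t) (yz s si) Mdv).
Qed.

End RegularSequences.

Arguments xform {K n} j.

(** * The integral closure of an ideal is an ideal *)

Section IdealPowers.
Variables (K : fieldType) (n : nat).
Local Notation S := {mpoly K[n]}.
Implicit Types (J L P : set S).

Lemma ideal_pow_ideal J k : is_ideal (ideal_pow J k).
Proof. by case: k => [|k]; [split|exact: ideal_gen_ideal]. Qed.

Lemma ideal_pow_mulS J k f g :
  J f -> ideal_pow J k g -> ideal_pow J k.+1 (f * g).
Proof. by move=> Jf Jg; apply: ideal_gen_mem; exists f, g. Qed.

Lemma ideal_pow_mul J i j f g :
  ideal_pow J i f -> ideal_pow J j g -> ideal_pow J (i + j) (f * g).
Proof.
elim: i f => [|i IH] f Jf Jg; first by apply: idealM => //; exact: ideal_pow_ideal.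
have hP := ideal_pow_ideal J (i.+1 + j).
apply: (ideal_gen_sub (P := [set f | ideal_pow J (i.+1 + j) (f * g)]) _ _ Jf).
  exact: ideal_colon.
move=> _ [a [b [Ja Jb ->]]]; rewrite /mkset -mulrA.
by apply: ideal_pow_mulS => //; exact: IH.
Qed.

End IdealPowers.

Section Rees.
Variables (K : fieldType) (n : nat) (J : set {mpoly K[n]}).
Local Notation S := {mpoly K[n]}.
Implicit Types f g : S.

(** The Rees algebra of [J], as a subring of [S['X]].  An element [f] of [S] is
    integral over [J] exactly when [f * 'X] is integral over this subring, so
    that the elements integral over [J] inherit the closure properties of
    integral ring elements. *)
Definition rees_pred : {pred {poly S}} :=
  fun p => `[< forall i, ideal_pow J i p`_i >].

Lemma rees_predP (p : {poly S}) :
  reflect (forall i, ideal_pow J i p`_i) (p \in rees_pred).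
Proof. exact: asboolP. Qed.

Fact rees_closed : subring_closed rees_pred.
Proof.
split=> [|p q /rees_predP hp /rees_predP hq|p q /rees_predP hp /rees_predP hq].
- apply/rees_predP => -[|i] //; rewrite coef1; exact: ideal0 (ideal_pow_ideal _ _).
- apply/rees_predP => i; rewrite coefB; apply: idealB => //; exact: ideal_pow_ideal.
- apply/rees_predP => i; rewrite coefM; apply: ideal_sum => [|j _ _].
    exact: ideal_pow_ideal.
  by rewrite -{1}(subnKC (ltn_ord j : j <= i)%N); exact: ideal_pow_mul.
Qed.

HB.instance Definition _ := GRing.isSubringClosed.Build {poly S} rees_pred rees_closed.

Record rees := Rees {rees_val : {poly S}; _ : rees_val \in rees_pred}.

HB.instance Definition _ := [isSub for rees_val].
HB.instance Definition _ := [Choice of rees by <:].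
HB.instance Definition _ := [SubChoice_isSubComNzRing of rees by <:].

Definition rees_inj : {rmorphism rees -> {poly S}} := val.

Lemma monomial_rees i f : ideal_pow J i f -> f%:P * 'X^i \in rees_pred.
Proof.
move=> Jf; apply/rees_predP => j; rewrite coefCM coefXn.
case: eqVneq => [->|_]; first by rewrite mulr1.
by rewrite mulr0; exact: ideal0 (ideal_pow_ideal _ _).
Qed.

(** Multiplying the coefficient [a i] of an equation of integral dependence by
    ['X^i] makes it an element of the Rees algebra; conversely, a monic equation
    for [f * 'X] of degree [d] has one for [f] as its part of degree [d] in ['X]. *)
Lemma integral_closureP f :
  integral_closure J f <-> integralOver rees_inj (f%:P * 'X).
Proof.
split=> [[d [a [d0 Ja E]]]|[p pm /rootP]].
  have /choice[b hb] : forall i, exists b : rees,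
      (1 <= i <= d)%N -> rees_inj b = (a i)%:P * 'X^i.
    move=> i; have [/Ja Jai|_] := boolP (1 <= i <= d)%N; last by exists 0.
    by exists (Rees (monomial_rees Jai)).
  move: rees_inj hb => phi hb; exists ('X^d + \poly_(j < d) b (d - j)%N).
    rewrite monicE lead_coefDl ?lead_coefXn // size_polyXn ltnS.
    exact: size_poly.
  apply/rootP; rewrite poly_def rmorphD rmorph_sum /= map_polyXn hornerD hornerXn horner_sum.
  transitivity ((f ^+ d + \sum_(1 <= i < d.+1) a i * f ^+ (d - i))%:P * 'X^d : {poly S}).
    rewrite polyCD mulrDl polyC_exp exprMn; congr (_ + _).
    rewrite big_add1 /= big_nat_rev /= big_mkord rmorph_sum mulr_suml.
    apply: eq_bigr => j _; rewrite /= map_polyZ map_polyXn hornerZ hornerXn.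
    have jd := ltn_ord j.
    have -> : (0 + d - j.+1).+1 = (d - j)%N by lia.
    rewrite hb; last by lia.
    have -> : (d - (d - j) = j)%N by lia.
    have -> : 'X^d = 'X^(d - j) * 'X^j :> {poly S} by rewrite -exprD subnK // ltnW.
    rewrite exprMn /= polyCM polyC_exp; ring.
  by rewrite E polyC0 mul0r.
rewrite (@horner_coef_wide _ (size p)) ?size_poly // => E.
have := monicP pm; rewrite lead_coefE.
case sp : (size p) E => [|d] E pd.
  by move/eqP: sp; rewrite size_poly_eq0 (negPf (monic_neq0 pm)).
have {}E : \sum_(j < d.+1) (rees_inj p`_j)`_(d - j) * f ^+ j = 0.
  have := congr1 (fun q : {poly S} => q`_d) E; rewrite coef0 coef_sum => {}E; rewrite -[RHS]E.
  apply: eq_bigr => j _; rewrite coef_map exprMn -polyC_exp  [_ * (_ * 'X^_)]mulrCA.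
  by rewrite coefCM coefMXn ltnNge -ltnS ltn_ord /= mulrC.
have d0 : (0 < d)%N.
  case: d pd E {sp} => // p0; rewrite big_ord1 p0 rmorph1 coef1 mul1r.
  by move/eqP; rewrite oner_eq0.
exists d, (fun i => (rees_inj p`_(d - i))`_i); split=> // [i _|].
  by apply/rees_predP; exact: valP.
have /= top : (rees_inj p`_d)`_0 = 1 by rewrite pd rmorph1 coef1.
rewrite -[RHS]E big_ord_recr /= subnn top mul1r [RHS]addrC; congr (_ + _).
rewrite big_add1 /= big_nat_rev /= big_mkord; apply: eq_bigr => j _.
have jd := ltn_ord j.
have -> : (0 + d - j.+1).+1 = (d - j)%N by lia.
by have -> : (d - (d - j) = j)%N by lia.
Qed.

(** By [integral_closureP] this amounts to the stability of integral ring elements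
    under sums and products. *)
Lemma integral_closure_ideal : is_ideal (integral_closure J).
Proof.
split.
- by apply/integral_closureP; rewrite polyC0 mul0r; exact: integral0.
- move=> f g /integral_closureP hf /integral_closureP hg.
  apply/integral_closureP.
  have -> : (f + g)%:P * 'X = f%:P * 'X + g%:P * 'X by rewrite polyCD mulrDl.
  exact: (integral_add hf hg).
- move=> a f /integral_closureP hf; apply/integral_closureP.
  have a0 : a%:P \in rees_pred by have := @monomial_rees 0 a I; rewrite mulr1.
  have -> : (a * f)%:P * 'X = rees_inj (Rees a0) * (f%:P * 'X).
    by rewrite polyCM -mulrA.
  exact: (integral_mul (integral_id rees_inj (Rees a0)) hf).
Qed.

Lemma integral_of_sq f : ideal_pow J 2 (f ^+ 2) -> integral_closure J f.
Proof.
move=> Jf; exists 2%N, (fun i => if i == 2%N then - f ^+ 2 else 0); split=> //.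
  move=> i _; case: eqP => [->|_].
    by apply: idealN => //; exact: ideal_pow_ideal.
  exact: ideal0 (ideal_pow_ideal _ _).
by rewrite big_ltn // big_nat1 /=; ring.
Qed.

End Rees.

(** * Monomial valuations *)

Section Valuations.
Variables (K : fieldType) (n : nat).
Local Notation S := {mpoly K[n]}.
Implicit Types (J : set S) (w : 'I_n -> nat) (m : 'X_{1..n}).

Definition wt w m : nat := (\sum_i w i * m i)%N.

Lemma wtD w m m' : wt w (m + m')%MM = (wt w m + wt w m')%N.
Proof.
by rewrite /wt -big_split; apply: eq_bigr => i _; rewrite mnmDE mulnDr.
Qed.

Lemma wt0 w : wt w 0%MM = 0%N.
Proof. by rewrite /wt big1 // => i _; rewrite mnm0E muln0. Qed.

Lemma wt1 w i : wt w U_(i)%MM = w i.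
Proof.
rewrite /wt (bigD1 i) //= mnm1E eqxx muln1 big1 ?addn0 // => j ji.
by rewrite mnm1E eq_sym (negPf ji) muln0.
Qed.

Lemma wtMn w m k : wt w (m *+ k)%MM = (wt w m * k)%N.
Proof.
elim: k => [|k IH]; first by rewrite mulm0n wt0 muln0.
by rewrite mulmS wtD IH mulnS.
Qed.

Lemma wt_sum w (I : Type) (r : seq I) (P : pred I) (F : I -> 'X_{1..n}) :
  wt w (\sum_(i <- r | P i) F i)%MM = (\sum_(i <- r | P i) wt w (F i))%N.
Proof.
by elim/big_rec2: _ => [|i y x _ <-]; [exact: wt0|exact: wtD].
Qed.

Definition supported (P : set 'X_{1..n}) : set S :=
  [set f | forall m, m \in msupp f -> P m].

Lemma supportedX (P : set 'X_{1..n}) m : supported P 'X_[m] <-> P m.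
Proof.
split=> [|Pm m']; first by apply; rewrite msuppX mem_head.
by rewrite msuppX inE => /eqP->.
Qed.

Lemma supported_ideal (P : set 'X_{1..n}) :
  (forall m m', P m' -> P (m + m')%MM) -> is_ideal (supported P).
Proof.
move=> hP; split=> [m|f g hf hg m|f g hg m]; first by rewrite msupp0.
- by move/msuppD_le; rewrite mem_cat => /orP[/hf|/hg].
- by move/msuppM_le => /allpairsP[[m1 m2] /= [_ /hg Pm2 ->]]; exact: hP.
Qed.

Lemma supportedM (P Q R : set 'X_{1..n}) f g :
  (forall m m', P m -> Q m' -> R (m + m')%MM) ->
  supported P f -> supported Q g -> supported R (f * g).
Proof.
move=> PQR Pf Qg m /msuppM_le/allpairsP[[m1 m2] /= [/Pf P1 /Qg Q2 ->]].
exact: PQR.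
Qed.

Definition wt_ge w c : set S := supported [set m | (c <= wt w m)%N].

Lemma wt_ge_ideal w c : is_ideal (wt_ge w c).
Proof. by apply: supported_ideal => m m' /= h; rewrite wtD; lia. Qed.

Lemma wt_geM w c d f g : wt_ge w c f -> wt_ge w d g -> wt_ge w (c + d) (f * g).
Proof. by apply: supportedM => m m' /= hc hd; rewrite wtD leq_add. Qed.

Lemma wt_geX w c f k : wt_ge w c f -> wt_ge w (c * k) (f ^+ k).
Proof.
move=> hf; elim: k => [|k IH]; first by move=> m _ /=; rewrite muln0.
by rewrite exprS mulnS; exact: wt_geM.
Qed.

Lemma ideal_pow_wt_ge w c J k :
  J `<=` wt_ge w c -> ideal_pow J k `<=` wt_ge w (c * k).
Proof.
move=> Jc; elim: k => [|k IH]; first by move=> f _ m _ /=; rewrite muln0.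
apply: ideal_gen_sub => [|_ [f [g [Jf Jg ->]]]]; first exact: wt_ge_ideal.
by rewrite mulnS; apply: wt_geM; [exact: Jc|exact: IH].
Qed.

(** The lowest weight [v] occurring in [f] can be read off from the powers of
    [f], because the lowest part [f0] of [f] is not a zero divisor.  If [v] were
    less than [c], all the other terms of an equation of integral dependence
    would have weights exceeding those of [f0 ^+ d]. *)
Lemma integral_closure_wt_ge w c J :
  J `<=` wt_ge w c -> integral_closure J `<=` wt_ge w c.
Proof.
move=> Jc f [d [a [d0 Ja E]]]; apply: contrapT => nf.
have [m0 [m0f m0c]] : exists m, m \in msupp f /\ (wt w m < c)%N.
  apply: contrapT => H; apply: nf => m mf; rewrite /= leqNgt.
  by apply/negP => mc; apply: H; exists m.
pose Q v := has (fun m => wt w m == v) (msupp f).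
have exQ : exists v, Q v by exists (wt w m0); apply/hasP; exists m0.
case: (ex_minnP exQ) => v /hasP[m1 m1f /eqP m1v] vmin.
have vf : wt_ge w v f by move=> m mf; apply: vmin; apply/hasP; exists m.
have vc : (v < c)%N.
  by apply: leq_ltn_trans m0c; apply: vmin; apply/hasP; exists m0.
pose f0 : S := \sum_(m <- msupp f | wt w m == v) f@_m *: 'X_[m].
have f0E m : f0@_m = if wt w m == v then f@_m else 0.
  rewrite /f0 raddf_sum /= big_mkcond /=.
  case: (boolP (m \in msupp f)) => [mf|/[dup] nmf].
    rewrite (bigD1_seq m) //= big1 => [|m' m'm]; first rewrite addr0.
      by case: ifP => // _; rewrite mcoeffZ mcoeffX eqxx mulr1.
    by case: ifP => // _; rewrite mcoeffZ mcoeffX (negPf m'm) mulr0.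
  rewrite -mcoeff_eq0 => /eqP ->; rewrite if_same big_seq big1 // => m' m'f.
  case: ifP => // _; rewrite mcoeffZ mcoeffX; case: eqP => [mm|_].
    by rewrite mm (negPf nmf) in m'f.
  by rewrite mulr0.
have f0v : supported [set m | wt w m = v] f0.
  by move=> m; rewrite mcoeff_msupp f0E; case: (eqVneq (wt w m) v); rewrite ?eqxx.
have f00 : f0 != 0.
  apply/eqP => f0z; have := f0E m1; rewrite f0z mcoeff0 m1v eqxx => /esym/eqP.
  by rewrite mcoeff_eq0 m1f.
have f1v : wt_ge w v.+1 (f - f0).
  move=> m; rewrite mcoeff_msupp mcoeffB f0E /=.
  have [_|wv] := eqVneq (wt w m) v; first by rewrite subrr eqxx.
  rewrite subr0 -mcoeff_msupp => /vf /=; lia.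
have f0k k : supported [set m | wt w m = (v * k)%N] (f0 ^+ k).
  elim: k => [|k IH].
    by move=> m; rewrite expr0 msupp1 inE => /eqP->; rewrite /= wt0 muln0.
  rewrite exprS; apply: (supportedM _ f0v IH) => m m' /= h h'.
  by rewrite wtD h h' mulnS.
have f0w : wt_ge w v f0 by move=> m /f0v /= ->.
have fk k : wt_ge w (v * k).+1 (f ^+ k - f0 ^+ k).
  elim: k => [|k IH]; first by rewrite !expr0 subrr; exact: ideal0 (wt_ge_ideal _ _).
  have -> : f ^+ k.+1 - f0 ^+ k.+1 = f * (f ^+ k - f0 ^+ k) + (f - f0) * f0 ^+ k.
    by rewrite !exprS; ring.
  apply: (idealD (wt_ge_ideal w (v * k.+1).+1)).
    by rewrite mulnS -addnS; exact: wt_geM.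
  by rewrite mulnS -addSn; apply: wt_geM => //; exact: wt_geX.
have fd : wt_ge w (v * d).+1 (f ^+ d).
  have -> : f ^+ d = - \sum_(1 <= i < d.+1) a i * f ^+ (d - i).
    by apply/eqP; rewrite -addr_eq0 E.
  have hI := wt_ge_ideal w (v * d).+1.
  apply: (idealN hI); apply: (ideal_sum hI) => i; rewrite mem_index_iota => id _.
  move=> m /(wt_geM (ideal_pow_wt_ge Jc (Ja i id)) (wt_geX (k := d - i) vf)) /=.
  by nia.
have f0d : wt_ge w (v * d).+1 (f0 ^+ d).
  have -> : f0 ^+ d = f ^+ d - (f ^+ d - f0 ^+ d) by ring.
  exact: (idealB (wt_ge_ideal w (v * d).+1)).
have : f0 ^+ d != 0 by rewrite expf_neq0.
rewrite -msupp_eq0; case E0 : (msupp (f0 ^+ d)) => [//|m s] _.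
have md : m \in msupp (f0 ^+ d) by rewrite E0 mem_head.
by have := f0d m md; have := f0k d m md => /= ->; rewrite ltnn.
Qed.

End Valuations.

(** * A capacitated form of Koenig's theorem *)

Section Koenig.
Local Open Scope set_scope.
Variable T : finType.
Implicit Types (e : rel T) (X Y : {set T}) (a b : T -> nat).

Definition cover_pair e X Y := forall i j, e i j -> (i \in X) || (j \in Y).

(** Induction on the number of edges and on [k].  Let [(u, v)] be an edge with
    positive capacities at both ends.  If no cover of weight [k] contains both
    ends, then [(u, v)] is put in the matching and both capacities drop by one.
    If there is such a cover, then [(u, v)] is deleted: a cover of the remaining
    edges with weight less than [k] could be uncrossed with it into two covers
    of all edges, one of them having weight less than [k]. *)
Lemma capacitated_koenig e a b k :
  (forall X Y, cover_pair e X Y ->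
     (k <= \sum_(i in X) a i + \sum_(j in Y) b j)%N) ->
  exists es : seq (T * T), [/\ size es = k,
    forall p, p \in es -> e p.1 p.2,
    forall i, (count (fun p => p.1 == i) es <= a i)%N &
    forall j, (count (fun p => p.2 == j) es <= b j)%N].
Proof.
move: {-1}(k + #|[set p | e p.1 p.2]|)%N (leqnn (k + #|[set p | e p.1 p.2]|)) => N.
elim: N => [|N IH] in e a b k *.
  by rewrite leqn0 addn_eq0 => /andP[/eqP-> _] _; exists [::]; split.
case: k => [|k] hN hk; first by exists [::]; split.
have [u [v [euv au bv]]] : exists u v, [/\ e u v, (0 < a u)%N & (0 < b v)%N].
  apply: contrapT => H.
  have := hk [set i | a i == 0%N] [set j | b j == 0%N].
  have zero c : (\sum_(i in [set i | c i == 0%N]) c i = 0)%N.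
    by apply: big1 => i; rewrite inE => /eqP.
  rewrite !zero => /(_ _)/wrap[] // i j eij; rewrite !inE; apply: contrapT => /negP.
  rewrite negb_or -!lt0n => /andP[ai bj]; apply: H.
  by exists i, j.
pose lower (x : T) (c : T -> nat) i := (c i - (i == x))%N.
have sum_lower x c X : (0 < c x)%N ->
    (\sum_(i in X) c i = \sum_(i in X) lower x c i + (x \in X))%N.
  move=> cx; have [xX|xX] := boolP (x \in X); last first.
    rewrite addn0; apply: eq_bigr => i iX; rewrite /lower.
    by case: eqP => [ix|_]; [rewrite -ix iX in xX|rewrite subn0].
  rewrite (bigD1 x) //= [in RHS](bigD1 x) //= /lower eqxx.
  rewrite (eq_bigr (fun i => c i - (i == x))%N); first lia.
  by move=> i /andP[_ /negPf->]; rewrite subn0.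
have [[X [Y [cXY uX vY tight]]]|H] := pselect (exists X Y, [/\ cover_pair e X Y,
  u \in X, v \in Y & (\sum_(i in X) a i + \sum_(j in Y) b j = k.+1)%N]).
  pose e' := [rel i j | e i j && ((i, j) != (u, v))].
  have [||es [ses ees aes bes]] := IH e' a b k.+1.
  - rewrite -ltnS; apply: leq_trans hN; rewrite ltn_add2l; apply: proper_card.
    apply/properP; split; first by apply/fintype.subsetP => p; rewrite !inE => /andP[].
    by exists (u, v); rewrite !inE //= eqxx andbF.
  - move=> X' Y' cXY'.
    have c1 : cover_pair e (X :|: X') (Y :&: Y').
      move=> i j eij; rewrite !inE; have [[-> ->]|ij] := eqVneq (i, j) (u, v).
        by rewrite uX.
      have := cXY' i j; rewrite /= eij ij => /(_ isT).
      by have := cXY i j eij; case: (i \in X); case: (i \in X'); case: (j \in Y); case: (j \in Y').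
    have c2 : cover_pair e (X :&: X') (Y :|: Y').
      move=> i j eij; rewrite !inE; have [[-> ->]|ij] := eqVneq (i, j) (u, v).
        by rewrite vY orbT.
      have := cXY' i j; rewrite /= eij ij => /(_ isT).
      by have := cXY i j eij; case: (i \in X); case: (i \in X'); case: (j \in Y); case: (j \in Y').
    have sumUI c (Z Z' : {set T}) : (\sum_(i in Z :|: Z') c i + \sum_(i in Z :&: Z') c i
        = \sum_(i in Z) c i + \sum_(i in Z') c i)%N.
      rewrite ![(\sum_(i in _) _)%N]big_mkcond -!big_split /=.
      by apply: eq_bigr => i _; rewrite !inE; case: (i \in Z); case: (i \in Z') => /=; lia.
    have := hk _ _ c1; have := hk _ _ c2.
    have := sumUI a X X'; have := sumUI b Y Y'; lia.
  exists es; split=> // p /ees /andP[] //.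
have [||es [ses ees aes bes]] := IH e (lower u a) (lower v b) k.
- by move: hN; rewrite addSn.
- move=> X Y cXY; have := hk X Y cXY.
  rewrite (sum_lower u a) // (sum_lower v b) //.
  have [uX|] := boolP (u \in X); have [vY|] := boolP (v \in Y) => /=; try lia.
  rewrite leq_eqVlt => /orP[/eqP tight|]; last lia.
  exfalso; apply: H; exists X, Y; split=> //.
  by rewrite (sum_lower u a) // (sum_lower v b) // uX vY tight.
exists ((u, v) :: es); split=> [|p|i|j] /=.
- by rewrite ses.
- by rewrite inE => /orP[/eqP->|/ees].
- by have := aes i; rewrite /lower; case: (eqVneq u i) => [<-|_] /=; lia.
- by have := bes j; rewrite /lower; case: (eqVneq v j) => [<-|_] /=; lia.
Qed.

End Koenig.

(** * Integral closures of the powers of an edge ideal *)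

Section EdgeIdeals.
Variables (K : fieldType) (n : nat) (e : rel 'I_n).
Local Notation S := {mpoly K[n]}.
Local Notation I := (edge_ideal K e).
Hypothesis e_sym : ssrbool.symmetric e.
Implicit Types (w : 'I_n -> nat) (m : 'X_{1..n}).

(** Twice a fractional vertex cover. *)
Definition dcover w := forall i j, e i j -> (2 <= w i + w j)%N.

(** The lattice points of the [k]-fold dilate of the Newton polyhedron of [I]. *)
Definition newton k : set 'X_{1..n} :=
  [set m | forall w, dcover w -> (k.*2 <= wt w m)%N].

Lemma newton_up k m m' : newton k m' -> newton k (m + m')%MM.
Proof. by move=> h w /h; rewrite wtD; lia. Qed.

Lemma edge_pow (es : seq ('I_n * 'I_n)) : (forall p, p \in es -> e p.1 p.2) ->
  ideal_pow I (size es) 'X_[\sum_(p <- es) (U_(p.1) + U_(p.2))].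
Proof.
elim: es => [|p es IH] hes //; rewrite big_cons mpolyXD.
apply: ideal_pow_mulS; last by apply: IH => q qs; apply: hes; rewrite inE qs orbT.
apply: ideal_gen_mem; exists p.1, p.2; rewrite mpolyXD; split=> //.
by apply: hes; exact: mem_head.
Qed.

(** Pass to the bipartite double cover of the graph.  Its vertex covers are pairs
    of vertex sets, whose indicator functions add up to a double cover in the
    sense of [dcover], so that they have weight at least [2 k].  A matching of
    size [2 k] with capacities [m] writes the square of the monomial as a
    multiple of a product of [2 k] edges, and this splits into two products of
    [k] edges. *)
Lemma newton_sq k m : newton k m -> ideal_pow (ideal_pow I k) 2 ('X_[m] ^+ 2).
Proof.
move=> hm.
have [X Y cXY|es [ses ees aes bes]] := @capacitated_koenig _ e m m k.*2.
  have := hm (fun i => (i \in X) + (i \in Y))%N.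
  have -> : wt (fun i => (i \in X) + (i \in Y))%N m =
      (\sum_(i in X) m i + \sum_(i in Y) m i)%N.
    rewrite /wt ![(\sum_(i in _) _)%N]big_mkcond -big_split; apply: eq_bigr => i _.
    by case: (i \in X); case: (i \in Y) => /=; lia.
  apply=> i j eij; have := cXY i j eij.
  have : e j i by rewrite e_sym.
  by move=> /cXY; do 4![case: (_ \in _) => //=].
pose M (s : seq ('I_n * 'I_n)) := (\sum_(p <- s) (U_(p.1) + U_(p.2)))%MM : 'X_{1..n}.
pose c1 (s : seq ('I_n * 'I_n)) i := count (fun p => p.1 == i) s.
pose c2 (s : seq ('I_n * 'I_n)) i := count (fun p => p.2 == i) s.
have ME s i : M s i = (c1 s i + c2 s i)%N.
  rewrite /M /c1 /c2; elim: s => [|p s IH]; first by rewrite big_nil mnm0E.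
  by rewrite big_cons !mnmDE IH !mnm1E /=; lia.
have c1E i : c1 es i = (c1 (take k es) i + c1 (drop k es) i)%N.
  by rewrite /c1 -count_cat cat_take_drop.
have c2E i : c2 es i = (c2 (take k es) i + c2 (drop k es) i)%N.
  by rewrite /c2 -count_cat cat_take_drop.
have -> : 'X_[m] ^+ 2 = 'X_[m *+ 2 - M es] * ('X_[M (take k es)] * 'X_[M (drop k es)]) :> S.
  rewrite -!mpolyXD mpolyXn; congr 'X_[_]; apply/mnmP => i.
  have : (c1 es i <= m i)%N := aes i; have : (c2 es i <= m i)%N := bes i.
  rewrite !mnmDE mnmBE mulmnE !ME c1E c2E; lia.
apply: idealM; first exact: ideal_pow_ideal.
have hp s : {subset s <= es} -> size s = k -> ideal_pow I k 'X_[M s].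
  by move=> ss <-; apply: edge_pow => p /ss /ees.
apply: ideal_pow_mulS; [|rewrite -[X in ideal_pow _ _ X]mulr1; apply: ideal_pow_mulS => //].
  by apply: hp => [p /mem_take //|]; rewrite size_take ses; case: ifP; lia.
by apply: hp => [p /mem_drop //|]; rewrite size_drop ses; lia.
Qed.

(** The inclusion from right to left goes monomial by monomial, which is enough
    because the integral closure is closed under sums. *)
Lemma integral_closure_edge_pow k :
  integral_closure (ideal_pow I k) = supported (newton k).
Proof.
apply/seteqP; split=> [f cf m mf w cw|f hf].
  rewrite -mul2n; apply: (integral_closure_wt_ge _ cf) => //.
  apply: ideal_pow_wt_ge; apply: ideal_gen_sub => [|_ [i [j [eij ->]]]].
    exact: wt_ge_ideal.
  by rewrite -mpolyXD; apply/supportedX; rewrite /= wtD !wt1; exact: cw.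
have hI := integral_closure_ideal (ideal_pow I k).
rewrite [f]mpolyE; apply: (ideal_sum hI) => m mf _; rewrite -mul_mpolyC.
by apply: (idealM _ hI); apply: integral_of_sq; apply: newton_sq; exact: hf.
Qed.

End EdgeIdeals.

(** * Bipartite components *)

Section Components.
Variables (n : nat) (e : rel 'I_n).
Hypothesis e_sym : ssrbool.symmetric e.

(** The bipartite double cover: its paths remember the parity of the length of
    the walks of the graph. *)
Definition dbl : rel ('I_n * bool) := fun p q => e p.1 q.1 && (p.2 != q.2).

Definition component (i : 'I_n) : 'I_n := fingraph.root e i.

Definition bip_roots : {set 'I_n} :=
  [set r | (component r == r) && ~~ connect dbl (r, false) (r, true)].

(** The parity of the distance to the root, when the component is bipartite. *)
Definition colour (i : 'I_n) : bool := ~~ connect dbl (component i, false) (i, false).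

Let e_conn : connect_sym e. Proof. exact: sym_connect_sym. Qed.

Lemma dbl_conn : connect_sym dbl.
Proof.
by apply: sym_connect_sym => p q; rewrite /dbl e_sym eq_sym.
Qed.

Lemma comp_edge i j : e i j -> component i = component j.
Proof. by move=> eij; apply/eqP; rewrite root_connect // connect1. Qed.

Lemma comp_comp i : component (component i) = component i.
Proof. exact: root_root. Qed.

Lemma bip_root_comp r : r \in bip_roots -> component r = r.
Proof. by rewrite inE => /andP[/eqP]. Qed.

Lemma connect_lift i j b :
  connect e i j -> exists c, connect dbl (i, b) (j, c).
Proof.
case/connectP => p; elim: p i b => [|k p IH] i b /=; first by move=> _ ->; exists b.
case/andP => eik pk jE; have [c hc] := IH k (~~ b) pk jE.
exists c; apply: connect_trans hc; apply: connect1; rewrite /dbl /= eik.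
by case: b.
Qed.

Lemma connect_flip i j b c :
  connect dbl (i, b) (j, c) -> connect dbl (i, ~~ b) (j, ~~ c).
Proof.
case/connectP => p; elim: p i b => [|[k d] p IH] i b /=.
  by move=> _ [-> ->]; exact: connect0.
case/andP => ik pk jE; apply: (connect_trans _ (IH k d pk jE)); apply: connect1.
by move: ik {pk jE}; rewrite /dbl /=; case: (e i k); case: b; case: d.
Qed.

Lemma connect_colour i : connect dbl (component i, false) (i, colour i).
Proof.
rewrite /colour; case E: (connect dbl (component i, false) (i, false)) => //=.
have : connect e (component i) i by rewrite e_conn connect_root.
by case/(connect_lift false) => -[] h; rewrite ?E in h *.
Qed.

Lemma colour_root r : component r = r -> colour r = false.
Proof. by rewrite /colour => ->; rewrite connect0. Qed.

Lemma colour_edge i j : component i \in bip_roots -> e i j -> colour j = ~~ colour i.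
Proof.
move=> iB eij; apply/eqP; rewrite -[_ == _]negbK -addbN negbK; apply/negP => ij.
have {}ij : colour i = colour j by move: ij; case: (colour i); case: (colour j).
move: iB; rewrite inE => /andP[_ /negP]; apply.
apply: (connect_trans (y := (j, ~~ colour i))).
  apply: connect_trans (connect_colour i) _; apply: connect1.
  by rewrite /dbl /= eij; case: (colour i).
rewrite dbl_conn (comp_edge eij) ij; exact: (connect_flip (connect_colour j)).
Qed.

Lemma isolated_comp i r :
  (forall j, ~~ e r j) -> component i = r -> i = r.
Proof.
move=> iso ir; have : connect e r i by rewrite -ir e_conn connect_root.
by case/connectP => -[|k p] //= /andP[]; rewrite (negPf (iso k)).
Qed.

Definition tight (w : 'I_n -> nat) := forall i j, e i j -> (w i + w j = 2)%N.

Section Tight.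
Variable w : 'I_n -> nat.
Hypothesis w_tight : tight w.

Lemma tight_connect i j b c : connect dbl (i, b) (j, c) ->
  if b == c then w i = w j else (w i + w j = 2)%N.
Proof.
case/connectP => p; elim: p i b => [|[k d] p IH] i b /=.
  by move=> _ [-> ->]; rewrite eqxx.
case/andP => /andP[/= /w_tight wik bd] pk jE; have := IH k d pk jE.
by move: bd wik {pk jE IH}; case: b; case: c; case: d => //= _; lia.
Qed.

(** Along an edge a tight function passes from [a] to [2 - a].  An odd closed walk
    thus forces the value [1] everywhere on its component. *)
Lemma tight_nonbip i : component i \notin bip_roots -> w i = 1%N.
Proof.
rewrite inE comp_comp eqxx negbK => /tight_connect /= h.
have := tight_connect (connect_colour i); case: eqP; lia.
Qed.

Lemma tight_colour i j :
  component i = component j -> colour i != colour j -> (w i + w j = 2)%N.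
Proof.
move=> ij; have := tight_connect (connect_colour i).
have := tight_connect (connect_colour j); rewrite -ij.
by case: (colour i); case: (colour j) => //=; lia.
Qed.

End Tight.

End Components.

(** * The upper bound for the depth *)

Section DepthBound.
Variables (K : fieldType) (n : nat) (e : rel 'I_n).
Hypothesis e_sym : ssrbool.symmetric e.
Local Notation S := {mpoly K[n]}.
Local Notation B := (bip_roots e).
Local Notation component := (component e).
Local Notation colour := (colour e).
Implicit Types (r x y : 'I_n) (rs s : seq 'I_n) (b : 'X_{1..n}) (c : seq 'I_n -> S).

Definition neighbour r : option 'I_n := [pick j | e r j].

Lemma neighbour_Some r y : r \in B -> neighbour r = Some y ->
  component y = r /\ colour y = true.
Proof.
rewrite /neighbour; case: pickP => // y' ery rB [yE]; rewrite -{}yE {y}.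
have rr := bip_root_comp rB; rewrite -(comp_edge e_sym ery) rr; split=> //.
by rewrite (colour_edge e_sym _ ery) ?(colour_root rr) ?rr.
Qed.

Lemma neighbour_None r j : neighbour r = None -> e r j = false.
Proof. by rewrite /neighbour; case: pickP => // h _; exact: h. Qed.

(** A cocycle of degree one for each bipartite component.  On an isolated vertex
    it is what remains of the form [xform] after division by the variable. *)
Definition side_form r (j : 'I_n) : S :=
  if neighbour r is Some _ then
    if (component j == r) && ~~ colour j then xform j else 0
  else (j == r)%:R.

Definition side_class (u : S) rs : seq 'I_n -> S :=
  foldr (fun r => wedge (side_form r)) (fun s => if s is [::] then u else 0) rs.

Lemma side_class_mem (P : set S) u rs s : is_ideal P -> P u -> P (side_class u rs s).
Proof.
move=> hP Pu; elim: rs s => [[|i s] //=|r rs IH s]; first exact: ideal0.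
by apply: wedge_mem => // j t; exact: idealM.
Qed.

(** The values of the class are sums of multiples of products of [u] with a vertex
    from the side of [r]. *)
Lemma side_class_mem_side (P : set S) u rs r y s : is_ideal P ->
  r \in rs -> neighbour r = Some y ->
  (forall i, component i = r -> colour i = false -> P (xform i * u)) ->
  P (side_class u rs s).
Proof.
move=> hP + ry Pu; elim: rs s => // r' rs IH s; rewrite inE.
have [<- _|_ /= rrs] := eqVneq r r'; apply: wedge_mem => // j t; last first.
  by apply: idealM => //; exact: IH.
rewrite mulrC; apply: (side_class_mem (P := [set a | P (a * side_form r j)])).
  exact: ideal_colon.
rewrite /= /side_form ry mulrC; case: ifP => [/andP[/eqP jr /negPf jc]|_].
  exact: Pu.
by rewrite mul0r; exact: ideal0.
Qed.

Lemma wedge_side_class u rs r s :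
  r \in rs -> wedge (side_form r) (side_class u rs) s = 0.
Proof.
elim: rs s => // r' rs IH s; rewrite inE.
have [<- _|_ /= rrs] := eqVneq r r'; first exact: wedge_sq.
by rewrite wedge_anticomm wedge0 ?oppr0 // => t; exact: IH.
Qed.

Definition side_coef r : S := if neighbour r is Some _ then 1 else xform r.

Definition rest_form (j : 'I_n) : S :=
  if component j \in B then
    if neighbour (component j) is Some _ then if colour j then xform j else 0 else 0
  else xform j.

(** The Koszul differential splits into multiplications by the forms of the
    components, which annihilate the class, and by the remaining form, which
    maps it into the submodule to be divided out. *)
Lemma xform_decomposition (j : 'I_n) :
  xform j = \sum_(r <- enum B) side_coef r * side_form r j + rest_form j.
Proof.
have other r : r \in B -> r != component j -> side_coef r * side_form r j = 0.
  move=> rB rj; rewrite /side_form; case: (neighbour r) => [_|].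
    by rewrite eq_sym (negPf rj) mulr0.
  have [jr|_] := eqVneq j r; last by rewrite mulr0.
  by rewrite jr (bip_root_comp rB) eqxx in rj.
rewrite /rest_form big_enum /=; case: ifPn => jB; last first.
  rewrite big1 ?add0r // => r rB; apply: other => //.
  by apply: contraNneq jB => <-.
rewrite (bigD1 (component j)) //= [X in _ + X + _]big1 => [|r /andP[rB rj]]; last exact: other.
rewrite addr0 /side_coef /side_form; case E : (neighbour (component j)) => [y|].
  by rewrite eqxx /=; case: (colour j); rewrite ?mul1r ?mulr0 ?addr0 ?add0r.
have jr : j = component j.
  by apply: (isolated_comp e_sym) => // k; rewrite (neighbour_None _ E).
by rewrite -jr eqxx mulr1 addr0.
Qed.

Lemma wedge_xform c s :
  wedge xform c s = \sum_(r <- enum B) side_coef r * wedge (side_form r) c s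
                  + wedge rest_form c s.
Proof.
have -> : xform = fun j => \sum_(r <- enum B) side_coef r * side_form r j + rest_form j.
  by apply/funext => j; exact: xform_decomposition.
elim: (enum B) => [|r rs IH].
  rewrite big_nil add0r; congr (wedge _ _ _).
  by apply/funext => j; rewrite big_nil add0r.
rewrite big_cons -addrA -IH -wedge_lin; congr (wedge _ _ _).
by apply/funext => j; rewrite big_cons addrA.
Qed.

(** The cross-polytope spanned by the pairs formed by a root and a neighbour of
    it, as a functional on cochains: the alternating sum of one coefficient of
    each of the values on its facets.  Isolated roots belong to every facet. *)
Fixpoint evaluation b rs c : K :=
  if rs is r :: rs' then
    if neighbour r is Some y then
      evaluation (b + U_(r))%MM rs' (fun t => c (r :: t)) -
      evaluation (b + U_(y))%MM rs' (fun t => c (y :: t))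
    else evaluation b rs' (fun t => c (r :: t))
  else (c [::])@_b.

Lemma evaluationB b rs c c' :
  evaluation b rs (fun s => c s - c' s) = evaluation b rs c - evaluation b rs c'.
Proof.
elim: rs b c c' => [|r rs IH] b c c' /=; first exact: mcoeffB.
by case: (neighbour r) => [y|]; rewrite !IH //; ring.
Qed.

Lemma evaluation_const0 b rs : evaluation b rs (fun=> 0) = 0.
Proof.
by elim: rs b => [|r rs IH] b /=; [exact: mcoeff0|case: (neighbour r) => [y|]; rewrite !IH ?subr0].
Qed.

Lemma evaluation_ext b rs c c' : (forall s, c s = c' s) ->
  evaluation b rs c = evaluation b rs c'.
Proof. by move=> cc'; congr (evaluation _ _ _); apply/funext. Qed.

Lemma evaluationX b rs x c :
  evaluation (b + U_(x))%MM rs (fun s => xform x * c s) = evaluation b rs c.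
Proof.
elim: rs b c => [|r rs IH] b c /=; first by rewrite mulrC addmC mcoeffMX.
have addAC y : (b + U_(x) + U_(y) = b + U_(y) + U_(x))%MM by rewrite -!addmA (addmC U_(x)%MM).
by case: (neighbour r) => [y|]; rewrite ?addAC !(IH _ (fun t => c (_ :: t))).
Qed.

Lemma evaluationX0 b rs x c : neighbour x = None -> b x = 0%N ->
  evaluation b rs (fun s => xform x * c s) = 0.
Proof.
move=> nx; elim: rs b c => [|r rs IH] b c bx /=.
  apply/eqP; rewrite mcoeff_eq0 mulrC; apply/negP.
  rewrite (perm_mem (msuppMX _ _)) => /mapP[m _ bE].
  by move: bx; rewrite bE mnmDE mnm1E eqxx.
case E : (neighbour r) => [y|]; last exact: IH.
have [erx ery] : r != x /\ y != x.
  split; first by apply/eqP => rx; rewrite rx nx in E.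
  move: E; rewrite /neighbour; case: pickP => // z erz [<-]; apply/eqP => zx.
  by move: erz; rewrite zx e_sym (neighbour_None _ nx).
by rewrite !IH ?subr0 // mnmDE bx mnm1E ?(negPf erx) ?(negPf ery).
Qed.

(** The two facets opposite to each other along the first axis contribute the
    same value, with opposite signs. *)
Lemma evaluation_coboundary b rs c :
  (forall r, r \in rs -> neighbour r = None -> b r = 0%N) ->
  evaluation b rs (wedge xform c) = 0.
Proof.
elim: rs b c => [|r rs IH] b c b0 /=; first exact: mcoeff0.
case E : (neighbour r) => [y|].
  have IH' x (c' : seq 'I_n -> S) : e r x || (x == r) ->
      evaluation (b + U_(x))%MM rs (wedge xform c') = 0.
    move=> hx; apply: IH => r' r'rs nr'; rewrite mnmDE b0 ?inE ?r'rs ?orbT // mnm1E add0n.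
    case: eqVneq => // xr'; move: hx; rewrite xr' e_sym (neighbour_None _ nr') /=.
    by move=> /eqP r'r; rewrite r'r E in nr'.
  have ery : e r y by move: E; rewrite /neighbour; case: pickP => // z ? [<-].
  rewrite !evaluationB !evaluationX !IH' ?eqxx ?orbT ?ery // !subr0.
  exact: subrr.
rewrite evaluationB IH => [|r' r'rs]; last by apply: b0; rewrite inE r'rs orbT.
by rewrite evaluationX0 ?subr0 // b0 ?mem_head.
Qed.

Lemma evaluation_wedge0 b rs lam c :
  (forall r, r \in rs -> lam r = 0 /\ forall y, neighbour r = Some y -> lam y = 0) ->
  evaluation b rs (wedge lam c) = 0.
Proof.
elim: rs b c => [|r rs IH] b c lam0 /=; first exact: mcoeff0.
have {}IH b' (c' : seq 'I_n -> S) x : lam x = 0 ->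
    evaluation b' rs (fun t => lam x * c' t - wedge lam (fun t => c (x :: t)) t) = 0.
  move=> lx; rewrite evaluationB IH => [|r' r'rs]; last by apply: lam0; rewrite inE r'rs orbT.
  rewrite subr0 -[RHS](evaluation_const0 b' rs); apply: evaluation_ext => t.
  by rewrite lx mul0r.
have [lr ly] := lam0 r (mem_head _ _).
by case E : (neighbour r) => [y|]; rewrite !IH ?subr0 //; exact: ly.
Qed.

(** Among the facets only the one spanned by the roots contributes, since the form
    of a component vanishes at the neighbour of its root and on the other
    components. *)
Lemma evaluation_side_class b rs u : uniq rs -> {subset rs <= B} ->
  evaluation b rs (side_class u rs) = u@_b.
Proof.
elim: rs b => [//|r rs IH] b /= /andP[rrs urs] rsB.
have rB : r \in B by apply: rsB; exact: mem_head.
have rsB' : {subset rs <= B} by move=> r' r'rs; apply: rsB; rewrite inE r'rs orbT.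
have ev0 b' (c : seq 'I_n -> S) : evaluation b' rs (wedge (side_form r) c) = 0.
  apply: evaluation_wedge0 => r' r'rs; have r'r : r' != r by apply: contraNneq rrs => <-.
  have r'B := rsB' _ r'rs; rewrite /side_form; split=> [|y /(neighbour_Some r'B)[yr' _]].
    by rewrite (bip_root_comp r'B) (negPf r'r); case: (neighbour r).
  rewrite yr' (negPf r'r); case: (neighbour r) => //.
  have [yr|//] := eqVneq y r.
  by rewrite yr (bip_root_comp rB) in yr'; rewrite yr' eqxx in r'r.
case E : (neighbour r) => [y|]; last first.
  rewrite evaluationB ev0 subr0 -(IH b urs rsB'); apply: evaluation_ext => t.
  by rewrite /side_form E eqxx mul1r.
have [yr yc] := neighbour_Some rB E; have rr := bip_root_comp rB.
rewrite !evaluationB !ev0 !subr0.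
have -> : side_form r r = xform r by rewrite /side_form E rr eqxx colour_root.
have -> : side_form r y = 0 by rewrite /side_form E yr yc eqxx.
rewrite evaluationX IH // -[RHS]subr0; congr (_ - _).
by rewrite -[RHS](evaluation_const0 (b + U_(y))%MM rs); apply: evaluation_ext => t; rewrite mul0r.
Qed.

(** The tight function that is zero on the side [f r] of each bipartite component
    with root [r]. *)
Definition side_cover (f : 'I_n -> bool) (i : 'I_n) : nat :=
  if component i \in B then if colour i == f (component i) then 0%N else 2%N else 1%N.

Lemma side_cover_edge f i j : e i j -> (side_cover f i + side_cover f j = 2)%N.
Proof.
move=> eij; rewrite /side_cover -(comp_edge e_sym eij); case: ifP => // iB.
by rewrite (colour_edge e_sym iB eij); case: (colour i); case: (f _).
Qed.

Lemma side_cover_dcover f : dcover e (side_cover f).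
Proof. by move=> i j eij; rewrite side_cover_edge. Qed.

(** The functional only involves monomials obtained by multiplying with vertices
    from distinct components, and for each of these monomials there is a cover
    giving weight zero to all these vertices. *)
Lemma evaluation_newton k b rs c (f0 : 'I_n -> bool) :
  uniq rs -> {subset rs <= B} ->
  (forall s, size s = size rs -> supported (newton e k) (c s)) ->
  (forall f, (forall r, r \notin rs -> f r = f0 r) -> (wt (side_cover f) b < k.*2)%N) ->
  evaluation b rs c = 0.
Proof.
elim: rs b c f0 => [|r rs IH] b c f0 /=.
  move=> _ _ /(_ [::] erefl) cs /(_ f0 (fun _ _ => erefl)) hb.
  apply/eqP; rewrite mcoeff_eq0; apply/negP => /cs /(_ _ (@side_cover_dcover f0)).
  by rewrite leqNgt hb.
move=> /andP[rrs urs] rsB cs hb.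
have rB : r \in B by apply: rsB; exact: mem_head.
have rsB' : {subset rs <= B} by move=> r' r'rs; apply: rsB; rewrite inE r'rs orbT.
have cs' x s : size s = size rs -> supported (newton e k) (c (x :: s)).
  by move=> ss; apply: cs => /=; rewrite ss.
have step x : component x = r -> evaluation (b + U_(x))%MM rs (fun t => c (x :: t)) = 0.
  move=> xr; apply: (IH _ _ (fun i => if i == r then colour x else f0 i)) => //.
    exact: cs'.
  move=> f hf; rewrite wtD wt1 {2}/side_cover xr rB (hf r rrs) !eqxx addn0.
  apply: hb => i; rewrite inE negb_or => /andP[ir irs].
  by rewrite (hf i irs) (negPf ir).
case E : (neighbour r) => [y|]; last first.
  apply: (IH _ _ f0) => // [|f hf]; first exact: cs'.
  by apply: hb => i; rewrite inE negb_or => /andP[_]; exact: hf.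
by rewrite !step ?subr0 ?(bip_root_comp rB) // (neighbour_Some rB E).1.
Qed.

(** The hypotheses on the exponent [b] make the class [z] built on it a cocycle
    with values in the module that is not killed by [evaluation].  As
    [evaluation] does kill the coboundaries and the submodule divided out, the
    cohomology in degree [#|B|] does not vanish, which excludes longer regular
    sequences. *)
Lemma depth_le_bip k b :
  newton e k b ->
  (forall i j, component i \in B -> component i = component j -> colour i = false ->
     colour j = true -> newton e k.+1 (b + U_(i) + U_(j))%MM) ->
  (forall j, component j \notin B -> newton e k.+1 (b + U_(j))%MM) ->
  (forall f, (wt (side_cover f) b < k.+1.*2)%N) ->
  (forall r, r \in B -> neighbour r = None -> b r = 0%N) ->
  enat_le (depth (supported (newton e k) : set S) (supported (newton e k.+1)))
          (Some #|B|).
Proof.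
move=> bk bXY bnon bside biso.
set J := supported (newton e k); set L := supported (newton e k.+1).
have hJ : is_ideal J by apply: supported_ideal => m m'; exact: newton_up.
have hL : is_ideal L by apply: supported_ideal => m m'; exact: newton_up.
rewrite /depth; case: ifPn => [/asboolP JL|_].
  have /JL/supportedX/(_ _ (@side_cover_dcover (fun=> false))) : J 'X_[b].
    exact/supportedX.
  by rewrite leqNgt bside.
apply: (enat_supP _).2 => _ [fs [irr reg ->]] /=; rewrite leqNgt; apply/negP => pfs.
pose z := side_class 'X_[b] (enum B).
have Jz s : J (z s) by apply: (side_class_mem _ _ hJ); exact/supportedX.
have Lz s : L (wedge xform z s).
  rewrite wedge_xform; apply: (idealD hL).
    by apply: (ideal_sum hL) => r rB _; rewrite wedge_side_class // mulr0; exact: ideal0.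
  apply: (wedge_mem _ hL) => j t; rewrite /rest_form; case: ifPn => jB; last first.
    rewrite mulrC; apply: (side_class_mem (P := [set a | L (a * xform j)])).
      exact: ideal_colon.
    by rewrite /= /xform -mpolyXD; apply/supportedX; exact: bnon.
  case E : (neighbour (component j)) => [y|]; last by rewrite mul0r; exact: ideal0.
  case: ifPn => jc; last by rewrite mul0r; exact: ideal0.
  rewrite mulrC.
  have cB : component j \in enum B by rewrite mem_enum.
  apply: (side_class_mem_side t (ideal_colon (xform j) hL) cB E).
  move=> i ij ic; rewrite /mkset; have -> : xform i * 'X_[b] * xform j = 'X_[b + U_(i) + U_(j)] :> S.
    by rewrite !mpolyXD [xform i * _]mulrC.
  by apply/supportedX; apply: bXY; rewrite ?ij.
have [w hw] := @regular_sequence_vanishing _ _ J L fs #|B| z hJ hL irr reg pfs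
  (fun s _ => Jz s) (fun s _ => Lz s).
have ubs : uniq (enum B) := enum_uniq _.
have sB : {subset enum B <= B} by move=> r; rewrite mem_enum.
have := @evaluation_newton k.+1 b (enum B) (fun s => z s - wedge xform w s)
  (fun=> false) ubs sB.
rewrite evaluationB evaluation_side_class // evaluation_coboundary; last first.
  by move=> r /sB; exact: biso.
rewrite subr0 mcoeffX eqxx -cardE => /(_ hw (fun f _ => bside f)) /eqP.
by rewrite oner_eq0.
Qed.

End DepthBound.

(** * Stanley decompositions from partitions of monomials *)

Section Partition.
Variables (K : fieldType) (n : nat).
Local Notation S := {mpoly K[n]}.
Implicit Types (P Q : set 'X_{1..n}) (m b : 'X_{1..n}).

Definition cone (Z : 'X_{1..n} -> {set 'I_n}) b m : Prop :=
  forall i, (b i <= m i)%N /\ (i \notin Z b -> m i = b i).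

Lemma cone_addE Z b m : cone Z b (b + m)%MM <-> (forall i, m i != 0%N -> i \in Z b).
Proof.
split=> h i; last first.
  by rewrite mnmDE leq_addr; split=> // /(contraNN (h i)); rewrite negbK => /eqP->; lia.
have [_] := h i; rewrite mnmDE; case: (boolP (i \in Z b)) => // _ /(_ isT); lia.
Qed.

(** A module spanned by monomials is graded with components of dimension at most
    one, so that a partition of its exponents into cones is a Stanley
    decomposition. *)
Lemma cone_stanley_decomposition P Q (bs : seq 'X_{1..n}) Z :
  uniq bs ->
  (forall b m, b \in bs -> cone Z b m -> P m /\ ~ Q m) ->
  (forall m, P m -> ~ Q m -> exists2 b, b \in bs & cone Z b m) ->
  (forall b b' m, b \in bs -> b' \in bs -> cone Z b m -> cone Z b' m -> b = b') ->
  stanley_decomposition (supported P : set S) (supported Q : set S)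
    (fun i : 'I_(size bs) => 'X_[nth 0%MM bs i])
    (fun i : 'I_(size bs) => Z (nth 0%MM bs i)).
Proof.
move=> ubs coneA coverA disj.
pose B (i : 'I_(size bs)) := nth 0%MM bs i.
have Bin i : B i \in bs by exact: mem_nth.
have cone_term i (p : S) m : poly_in (Z (B i)) p -> m \in msupp ('X_[B i] * p) -> cone Z (B i) m.
  move=> hp; rewrite mulrC (perm_mem (msuppMX _ _)) => /mapP[m' m'p ->].
  by apply/cone_addE; exact: hp.
split.
- move=> i; split; first split.
  + apply/supportedX; apply: (coneA (B i) (B i) (Bin i) _).1 => j.
    by split=> //; exact: leqnn.
  + by exists 1, (B i); rewrite scale1r.
  + move=> p hp Qp; apply: msuppnil0; case E : (msupp p) => [//|m s]; exfalso.
    have mp : m \in msupp p by rewrite E mem_head.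
    have mBp : (m + B i)%MM \in msupp ('X_[B i] * p).
      by rewrite mulrC mcoeff_msupp addmC mcoeffMX -mcoeff_msupp.
    by case: (coneA (B i) _ (Bin i) (cone_term i p _ hp mBp)) => _; apply; exact: Qp.
- move=> f Pf.
  (* [g m] is the index of the cone containing [m], if there is one. *)
  have /choice[g hg] : forall m, exists i : option 'I_(size bs),
      if i is Some i then cone Z (B i) m else P m -> Q m.
    move=> m; have [[b bbs bm]|nb] := pselect (exists2 b, b \in bs & cone Z b m).
      have ib : (index b bs < size bs)%N by rewrite index_mem.
      by exists (Some (Ordinal ib)); rewrite /B nth_index.
    by exists None => Pm; apply: contrapT => nQ; apply: nb; exact: coverA.
  pose p i : S := \sum_(m <- msupp f | g m == Some i) f@_m *: 'X_[(m - B i)%MM].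
  exists p; split=> [i m|].
    move/msupp_sum_le => /flattenP[s /mapP[m' ]].
    rewrite mem_filter => /andP[/eqP gm' _] -> /msuppZ_le.
    rewrite msuppX inE => /eqP->.
    have := hg m'; rewrite gm' => cm'; have := cm'.
    have {1}-> : m' = (B i + (m' - B i))%MM.
      by apply/mnmP => j; rewrite mnmDE mnmBE subnKC //; exact: (cm' j).1.
    by move/cone_addE.
  have -> : f - \sum_(i < size bs) 'X_[nth 0%MM bs i] * p i =
      \sum_(m <- msupp f | g m == None) f@_m *: 'X_[m].
    have -> : \sum_(i < size bs) 'X_[nth 0%MM bs i] * p i =
        \sum_(m <- msupp f) \sum_(i | g m == Some i) f@_m *: 'X_[m].
      rewrite (exchange_big_dep xpredT) //=; apply: eq_bigr => i _.
      rewrite mulr_sumr; apply: eq_bigr => m /eqP gm.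
      rewrite -scalerAr -mpolyXD; congr (_ *: 'X_[_]); apply/mnmP => j.
      by rewrite mnmDE mnmBE subnKC //; have := hg m; rewrite gm => /(_ j)[].
    rewrite {1}[f]mpolyE -sumrB [RHS]big_mkcond; apply: eq_bigr => m _.
    case: (g m) => [i|]; last by rewrite big1 ?subr0.
    rewrite (bigD1 i) //= big1 ?addr0 ?subrr // => j /andP[/eqP[->]].
    by rewrite eqxx.
  move=> m /msupp_sum_le => /flattenP[s /mapP[m' ]].
  rewrite mem_filter => /andP[/eqP gm' m'f] -> /msuppZ_le.
  rewrite msuppX inE => /eqP->.
  by have := hg m'; rewrite gm'; apply; exact: Pf.
- move=> p hp Qp i.
  suff -> : 'X_[B i] * p i = 0 by move=> m; rewrite msupp0.
  apply: msuppnil0; case E : (msupp _) => [//|m s]; exfalso.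
  have mi : m \in msupp ('X_[B i] * p i) by rewrite E mem_head.
  have cm := cone_term i (p i) m (hp i) mi.
  case: (coneA (B i) m (Bin i) cm) => _; apply; apply: Qp.
  rewrite mcoeff_msupp raddf_sum (bigD1 i) //= big1 ?addr0 -?mcoeff_msupp // => j ji.
  apply/eqP; rewrite mcoeff_eq0; apply/negP => mj.
  have Bij := disj _ _ m (Bin j) (Bin i) (cone_term j (p j) m (hp j) mj) cm.
  have /eqP := Bij; rewrite /B nth_uniq // => /eqP /val_inj ij.
  by rewrite ij eqxx in ji.
Qed.

Lemma le_sdepth (J L : set S) p r (u : 'I_r -> S) Z :
  stanley_decomposition J L u Z -> (forall i, (p <= #|Z i|)%N) ->
  enat_le (Some p) (sdepth J L).
Proof.
move=> D hp; have H : enat_le (decomposition_sdepth Z) (sdepth J L).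
  by apply: (enat_supP _).1; exists r, u, Z.
have : enat_le (Some p) (decomposition_sdepth Z).
  rewrite /decomposition_sdepth; elim/big_ind: _ => [//|a b pa pb|i _].
    by rewrite /enat_min; case: ifP.
  exact: hp.
by move: H; case: (decomposition_sdepth Z) (sdepth J L) => [d|] [d'|] //=; lia.
Qed.

End Partition.

(** * The lower bound for the Stanley depth *)

Section StanleyDepthBound.
Variables (K : fieldType) (n : nat) (e : rel 'I_n).
Hypothesis e_sym : ssrbool.symmetric e.
Local Notation S := {mpoly K[n]}.
Local Notation B := (bip_roots e).
Local Notation component := (component e).
Local Notation colour := (colour e).
Implicit Types (w : 'I_n -> nat) (i j r : 'I_n) (b c m : 'X_{1..n}).

Definition comp_wt r w c : nat := (\sum_(j | component j == r) w j * c j)%N.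

Lemma wt_comp w c : wt w c = (\sum_r comp_wt r w c)%N.
Proof. by rewrite /wt (partition_big component xpredT). Qed.

Lemma leq_wt w c c' :
  (forall i, (w i == 0) || (c i <= c' i))%N -> (wt w c <= wt w c')%N.
Proof.
move=> h; apply: leq_sum => i _; case/orP: (h i) => [/eqP-> //|].
exact: leq_mul.
Qed.

Lemma leq_comp_wt r w c c' :
  (forall i, component i = r -> (w i == 0) || (c i <= c' i))%N ->
  (comp_wt r w c <= comp_wt r w c')%N.
Proof.
move=> h; apply: leq_sum => i /eqP ir; case/orP: (h i ir) => [/eqP-> //|].
exact: leq_mul.
Qed.

Definition comp_min r w c : Prop :=
  dcover e w /\ forall w', dcover e w' -> (comp_wt r w c <= comp_wt r w' c)%N.

(** A vertex is free if raising its exponent arbitrarily does not change the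
    least weight of a cover on its component. *)
Definition free c i : Prop := exists2 w, comp_min (component i) w c & w i = 0%N.

Lemma comp_min_ex r c : exists w, comp_min r w c.
Proof.
pose P (v : nat) := `[< exists2 w, dcover e w & comp_wt r w c = v >].
have exP : exists v, P v.
  exists (comp_wt r (fun=> 2%N) c); apply/asboolP; exists (fun=> 2%N) => //.
case: (ex_minnP exP) => v /asboolP[w cw <-] vmin.
by exists w; split=> // w' cw'; apply: vmin; apply/asboolP; exists w'.
Qed.

(** A minimal cover without zeros in a bipartite component weighs at least as
    much as the component itself, hence at least as much as the cover that is
    twice the lighter colour class. *)
Lemma free_ex r c : r \in B -> exists2 i, component i = r & free c i.
Proof.
move=> rB; have rr := bip_root_comp rB.
have [w [cw wmin]] := comp_min_ex r c.
have [[i ir wi]|nz] := pselect (exists2 i, component i = r & w i = 0%N).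
  by exists i => //; exists w => //; rewrite ir.
pose side t : nat := (\sum_(j | (component j == r) && (colour j == t)) c j)%N.
pose v t j : nat := (if component j == r then if colour j == t then 2 else 0 else 2)%N.
have cv t : dcover e (v t).
  move=> i j eij; rewrite /v -(comp_edge e_sym eij); case: ifP => // /eqP ir.
  by rewrite (colour_edge e_sym _ eij) ?ir //; case: (colour i); case: t.
have vE t : comp_wt r (v t) c = (side t).*2.
  rewrite /comp_wt /side -mul2n big_distrr big_mkcondr; apply: eq_bigr => j /eqP jr.
  by rewrite /v jr eqxx; case: ifP.
have sideE : (side true + side false <= comp_wt r w c)%N.
  have -> : (side true + side false = \sum_(j | component j == r) c j)%N.
    rewrite /side [RHS](bigID colour) /=; congr (_ + _)%N; apply: eq_bigl => j.
      by case: (colour j).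
    by case: (colour j).
  apply: leq_sum => j /eqP jr; rewrite leq_pmull // lt0n.
  by apply/eqP => wj; apply: nz; exists j.
have vmin t : (side t <= side (~~ t))%N -> comp_min r (v t) c.
  move=> st; split=> // w' /wmin; apply: leq_trans; rewrite vE.
  by move: sideE st; case: t => /=; lia.
have [st|st] := leqP (side true) (side false).
  exists r => //; exists (v true); first by rewrite rr; exact: vmin.
  by rewrite /v rr eqxx colour_root.
have [i ir ic] : exists2 i, component i = r & colour i = true.
  apply: contrapT => no; move: st; rewrite {2}/side big1 // => j /andP[/eqP jr /eqP jc].
  by case: no; exists j.
exists i => //; exists (v false); first by rewrite ir; apply: vmin; exact: ltnW.
by rewrite /v ir eqxx ic.
Qed.

Definition selected c i : Prop :=
  [/\ component i \in B, free c i & forall j, component j = component i -> free c j -> (i <= j)%N].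

Definition sel c : {set 'I_n} := [set i | `[< selected c i >]]%SET.

Lemma selP c i : reflect (selected c i) (i \in sel c).
Proof. by rewrite inE; exact: asboolP. Qed.

Lemma sel_uniq c i j : i \in sel c -> j \in sel c -> component i = component j -> i = j.
Proof.
move=> /selP[_ fi mi] /selP[_ fj mj] ij; apply/val_inj/anti_leq.
by rewrite mi ?mj.
Qed.

Lemma sel_ex c r : r \in B -> exists2 i, i \in sel c & component i = r.
Proof.
move=> rB; have [i0 i0r fi0] := free_ex c rB.
pose P i := (component i == r) && `[< free c i >].
have Pi0 : P i0 by rewrite /P i0r eqxx; apply/asboolP.
case: (arg_minnP (@nat_of_ord n) Pi0) => i /andP[/eqP ir /asboolP fi] imin.
exists i => //; apply/selP; split; rewrite ?ir // => j jr fj.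
by apply: imin; rewrite /P jr eqxx; apply/asboolP.
Qed.

Lemma card_sel c : (#|B| <= #|sel c|)%N.
Proof.
apply: leq_trans (leq_imset_card component (sel c)); apply: subset_leq_card.
by apply/fintype.subsetP => r /(sel_ex c)[i ic <-]; exact: imset_f.
Qed.

(** Raising a selected coordinate keeps the vertex free, and makes no other
    vertex free, so that the least free vertex remains the same. *)
Lemma sel_raise c c' i : i \in sel c ->
  (forall j, component j = component i -> j != i -> c' j = c j) -> (c i <= c' i)%N ->
  i \in sel c'.
Proof.
move=> /selP[iB [w [cw wmin] wi] imin] cc' ci.
have le_cc' w' : (comp_wt (component i) w' c <= comp_wt (component i) w' c')%N.
  apply: leq_comp_wt => j ji; apply/orP; right.
  by have [->//|/(cc' j ji)->] := eqVneq j i.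
have wE : (comp_wt (component i) w c' <= comp_wt (component i) w c)%N.
  apply: leq_comp_wt => j ji; have [->|/(cc' j ji)->] := eqVneq j i.
    by rewrite wi.
  by rewrite leqnn orbT.
apply/selP; split=> // [|j ji [w' [cw' wmin'] wj]].
  exists w => //; split=> // w' /wmin h.
  exact: leq_trans wE (leq_trans h (le_cc' w')).
apply: imin => //; exists w' => //; split=> // w2 cw2; rewrite ji.
apply: leq_trans (le_cc' w') _; rewrite -ji.
apply: leq_trans (wmin' w cw) _; rewrite ji.
exact: leq_trans wE (wmin w2 cw2).
Qed.

(** No edge joins different components, so that minimal covers of the bipartite
    components that vanish at the selected vertices can be glued with [w]. *)
Lemma sel_glue c w : dcover e w ->
  exists w', [/\ dcover e w', (forall i, i \in sel c -> w' i = 0%N) &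
    (wt w' c <= wt w c)%N].
Proof.
move=> cw.
have /choice[v hv] : forall r, exists v, dcover e v /\ (r \in B ->
    comp_min r v c /\ forall i, i \in sel c -> component i = r -> v i = 0%N).
  move=> r; have [rB|_] := boolP (r \in B); last by exists w.
  have [i ic ir] := sel_ex c rB; have /selP[_ [v vmin vi] _] := ic.
  exists v; split=> [|_]; first by case: vmin.
  by split=> [|j jc jr]; rewrite -?ir // (sel_uniq jc ic) // ir.
exists (fun j => if component j \in B then v (component j) j else w j); split.
- move=> i j eij; rewrite -(comp_edge e_sym eij); case: ifP => _; last exact: cw.
  by apply: (hv (component i)).1.
- move=> i ic; have /selP[iB _ _] := ic; rewrite iB.
  by apply: ((hv (component i)).2 iB).2.
rewrite !wt_comp; apply: leq_sum => r _; have [rB|rB] := boolP (r \in B).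
  rewrite (_ : comp_wt r _ c = comp_wt r (v r) c); first exact: ((hv r).2 rB).1.2.
  by apply: eq_bigr => j /eqP ->; rewrite rB.
rewrite leq_eqVlt; apply/orP; left; apply/eqP.
by apply: eq_bigr => j /eqP ->; rewrite (negPf rB).
Qed.

Definition raised c c' : Prop :=
  forall i, (c i <= c' i)%N /\ (i \notin sel c -> c' i = c i).

Lemma sel_raised c c' : raised c c' -> sel c' = sel c.
Proof.
move=> h; have sub i : i \in sel c -> i \in sel c'.
  move=> ic; apply: (sel_raise ic); last exact: (h i).1.
  move=> j ji jni; apply: (h j).2; apply: contraNN jni => jc.
  by rewrite (sel_uniq jc ic).
apply/setP => i; apply/idP/idP; last exact: sub.
move=> ic'; have /selP[iB _ _] := ic'; have [j jc ji] := sel_ex c iB.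
by rewrite (sel_uniq ic' (sub j jc)).
Qed.

(** The covers provided by [sel_glue] do not see the raised coordinates. *)
Lemma newton_raised k c c' : raised c c' -> newton e k c <-> newton e k c'.
Proof.
move=> h; split=> N w cw.
  by apply: leq_trans (N w cw) _; apply: leq_wt => i; rewrite (h i).1 orbT.
have [w' [cw' w'0 w'c]] := sel_glue c cw.
apply: leq_trans (N w' cw') (leq_trans _ w'c); apply: leq_wt => i.
by have [/w'0-> //|/(h i).2->] := boolP (i \in sel c); rewrite leqnn orbT.
Qed.

Definition set_coord c i t : 'X_{1..n} := [multinom if j == i then t else c j | j < n].

(** The apices of the cones: no selected coordinate can be lowered while its
    vertex stays selected.  By [reduced_ex] and [reduced_uniq] every exponent is
    raised from exactly one apex. *)
Definition reduced b : Prop :=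
  forall i, i \in sel b -> (0 < b i)%N -> i \notin sel (set_coord b i (b i).-1).

Lemma reduced_ex c : exists2 b, reduced b & raised b c.
Proof.
move: {2}(mdeg c) (leqnn (mdeg c)) => N; elim: N => [|N IH] in c *.
  rewrite leqn0 mdeg_eq0 => /eqP->; exists 0%MM => [i|i]; first by rewrite mnm0E.
  by split=> //; exact: leqnn.
move=> cN; have [rc|nrc] := pselect (reduced c).
  by exists c => // i; split=> //; exact: leqnn.
have [i [ic ci ic']] : exists i, [/\ i \in sel c, (0 < c i)%N & i \in sel (set_coord c i (c i).-1)].
  apply: contrapT => no; apply: nrc => i ic ci; apply/negP => ic'.
  by apply: no; exists i.
set c' := set_coord c i (c i).-1 in ic'.
have c'E j : c' j = if j == i then (c i).-1 else c j by rewrite mnmE.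
have c'c : raised c' c.
  move=> j; rewrite c'E; have [->|_] := eqVneq j i; last by split=> //; exact: leqnn.
  by split; [exact: leq_pred|rewrite ic'].
have [|b rb bc'] := IH c'.
  have cE : c = (c' + U_(i))%MM.
    by apply/mnmP => j; rewrite mnmDE c'E mnm1E; have [->|_] /= := eqVneq j i; lia.
  by move: cN; rewrite cE mdegD mdeg1; lia.
exists b => // j; have [h1 h2] := bc' j; have [h3 h4] := c'c j.
split; first exact: leq_trans h1 h3.
by move=> jb; rewrite h4 ?h2 // (sel_raised bc').
Qed.

Lemma reduced_uniq b b' c :
  reduced b -> reduced b' -> raised b c -> raised b' c -> b = b'.
Proof.
have half a a' : reduced a' -> raised a c -> raised a' c -> forall i, (a' i <= a i)%N.
  move=> ra' ac a'c i; rewrite leqNgt; apply/negP => lt.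
  have sE : sel a = sel a' by rewrite -(sel_raised ac) (sel_raised a'c).
  have ia' : i \in sel a'.
    apply: contraLR lt => ia'; rewrite -leqNgt -(a'c i).2 // (ac i).2 ?sE //.
  have /negP := ra' i ia' (leq_ltn_trans (leq0n _) lt); apply.
  rewrite -sE in ia'; apply: (sel_raise ia').
    move=> j ji jni; rewrite mnmE (negPf jni).
    have ja : j \notin sel a by apply: contraNN jni => ja; rewrite (sel_uniq ja ia').
    by rewrite -(ac j).2 // (a'c j).2 // -sE.
  by rewrite mnmE eqxx; lia.
move=> rb rb' bc b'c; apply/mnmP => i; apply/anti_leq.
by rewrite (half b' b) ?(half b b').
Qed.

Definition truncate t m : 'X_{1..n} := [multinom minn (m i) t | i < n].

(** A coordinate exceeding [t] already contributes a weight of at least [2 k],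
    unless its weight is zero. *)
Lemma newton_truncate k t m : (k.*2 <= t)%N ->
  newton e k (truncate t m) <-> newton e k m.
Proof.
move=> kt; split=> N w cw.
  apply: leq_trans (N w cw) _; apply: leq_wt => i.
  by rewrite mnmE geq_minl orbT.
have [[i [wi mi]]|no] := pselect (exists i, (0 < w i)%N /\ (t < m i)%N).
  apply: leq_trans kt _; rewrite /wt (bigD1 i) //= mnmE (minn_idPr (ltnW mi)).
  by apply: leq_trans (leq_addr _ _); rewrite leq_pmull.
apply: leq_trans (N w cw) _; apply: leq_wt => i; rewrite mnmE.
have [//|wi] := eqVneq (w i) 0%N; rewrite leq_min leqnn /= leqNgt; apply/negP => mi.
by apply: no; exists i; rewrite lt0n.
Qed.

Lemma sdepth_ge_bip k :
  enat_le (Some #|B|)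
    (sdepth (supported (newton e k) : set S) (supported (newton e k.+1))).
Proof.
pose t := k.+1.*2; pose A m := newton e k m /\ ~ newton e k.+1 m.
have A_raised c c' : raised c c' -> A c <-> A c'.
  by move=> h; rewrite /A !(newton_raised _ h).
have A_trunc m : A (truncate t m) <-> A m.
  by rewrite /A !newton_truncate // /t; lia.
(* The coordinates at which an apex reaches the bound of the truncation are free
   to grow as well. *)
pose Z b : {set 'I_n} := (sel b :|: [set i | b i == t])%SET.
pose cand := undup [seq [multinom (f i : nat) | i < n] | f : {ffun 'I_n -> 'I_t.+1}].
pose bs := [seq b <- cand | `[< A b /\ reduced b >]].
have bsP b : reflect [/\ A b, reduced b & forall i, (b i <= t)%N] (b \in bs).
  rewrite mem_filter mem_undup; apply: (iffP andP) => [[/asboolP[Ab rb] /mapP[f _ bE]]|].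
    by split=> // i; rewrite bE mnmE -ltnS ltn_ord.
  case=> Ab rb bt; split; first exact/asboolP.
  apply/mapP; exists [ffun i => inord (b i)]; first by rewrite mem_enum.
  by apply/mnmP => i; rewrite mnmE ffunE inordK // ltnS.
have cone_raised b m : (forall i, b i <= t)%N -> cone Z b m <-> raised b (truncate t m).
  have ZE i : (i \in Z b) = (i \in sel b) || (b i == t).
    by rewrite /Z finset.in_setU; congr (_ || _); rewrite finset.in_set.
  move=> bt; split=> h i; have := h i; have := bt i; rewrite mnmE ZE.
    case: (i \in sel b) => /= hb [bm bmE]; first by split=> //; lia.
    by case: eqP bmE => /= hbt => [_|/(_ isT) bmE]; split=> [|_]; lia.
  case: (i \in sel b) => /= hb [bm bmE]; first by split=> //; lia.
  by have {}bmE := bmE isT; case: eqP => /= hbt; split=> //; lia.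
apply: (@le_sdepth _ _ _ _ _ _ _ _ (@cone_stanley_decomposition K n _ _ bs Z _ _ _ _)).
- by rewrite filter_uniq // undup_uniq.
- move=> b m /bsP[Ab rb bt] /(cone_raised b m bt) bm.
  by apply/A_trunc; apply/(A_raised _ _ bm).
- move=> m Pm Qm; have [b rb bm] := reduced_ex (truncate t m).
  have bt i : (b i <= t)%N by apply: leq_trans (bm i).1 _; rewrite mnmE geq_minr.
  exists b; last exact/cone_raised.
  by apply/bsP; split=> //; apply/(A_raised _ _ bm)/A_trunc.
- move=> b b' m /bsP[_ rb bt] /bsP[_ rb' bt'] /(cone_raised b m bt) bm.
  by move/(cone_raised b' m bt'); exact: reduced_uniq.
- move=> i; apply: leq_trans (card_sel _) _; apply: subset_leq_card.
  exact: finset.subsetUl.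
Qed.

End StanleyDepthBound.

(** * The depth of the graded pieces *)

Section InteriorMonomial.
Variables (n : nat) (e : rel 'I_n).
Hypothesis e_sym : ssrbool.symmetric e.
Local Notation tight := (tight e).
Local Notation edges := [set p : 'I_n * 'I_n | e p.1 p.2]%SET.

(** Every edge occurs with multiplicity at least two, so that a cover that is
    not tight has an excess of two on this monomial. *)
Definition edge_monomial (x y : 'I_n) k : 'X_{1..n} :=
  (\sum_(p in edges) (U_(p.1) + U_(p.2)) *+ 2 +
   (U_(x) + U_(y)) *+ (k - #|edges|.*2))%MM.

Lemma edge_monomial_wt x y k w : wt w (edge_monomial x y k) =
  (\sum_(p in edges) (w p.1 + w p.2) * 2 + (w x + w y) * (k - #|edges|.*2))%N.
Proof.
rewrite /edge_monomial wtD wt_sum wtMn wtD !wt1; congr (_ + _)%N.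
by apply: eq_bigr => p _; rewrite wtMn wtD !wt1.
Qed.

Lemma edge_monomial_tight x y k w : (#|edges|.*2 <= k)%N -> e x y -> tight w ->
  wt w (edge_monomial x y k) = k.*2.
Proof.
move=> hk exy tw; rewrite edge_monomial_wt tw //.
have -> : (\sum_(p in edges) (w p.1 + w p.2) * 2 = #|edges| * 4)%N.
  by rewrite -sum_nat_const; apply: eq_bigr => p; rewrite inE => /tw ->.
by lia.
Qed.

Lemma edge_monomial_slack x y k w :
  (#|edges|.*2 <= k)%N -> e x y -> dcover e w -> ~ tight w ->
  (k.*2.+2 <= wt w (edge_monomial x y k))%N.
Proof.
move=> hk exy cw nt; rewrite edge_monomial_wt.
have [p [ep wp]] : exists p : 'I_n * 'I_n, e p.1 p.2 /\ (2 < w p.1 + w p.2)%N.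
  apply: contrapT => no; apply: nt => i j eij; apply/eqP.
  rewrite eqn_leq cw // andbT leqNgt; apply/negP => wij.
  by apply: no; exists (i, j).
have : (#|edges| * 4 + 2 <= \sum_(p in edges) (w p.1 + w p.2) * 2)%N.
  have pE : p \in edges by rewrite inE.
  rewrite -sum_nat_const (bigD1 p) //= [X in (_ <= X)%N](bigD1 p) //=.
  rewrite addnAC; apply: leq_add; first lia.
  by apply: leq_sum => q /andP[]; rewrite inE => /cw; lia.
have : (2 * (k - #|edges|.*2) <= (w x + w y) * (k - #|edges|.*2))%N.
  by rewrite leq_mul // cw.
by lia.
Qed.

Lemma edge_monomial_isolated x y k r :
  (forall j, e r j = false) -> e x y -> edge_monomial x y k r = 0%N.
Proof.
move=> iso; have edge0 i j c : e i j -> ((U_(i) + U_(j)) *+ c)%MM r = 0%N.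
  move=> eij; rewrite mulmnE mnmDE !mnm1E.
  have [ir|_] := eqVneq i r; first by rewrite ir iso in eij.
  by have [jr|_] := eqVneq j r; first by rewrite jr e_sym iso in eij.
move=> exy; rewrite mnmDE mnm_sumE edge0 // big1 // => p; rewrite inE; exact: edge0.
Qed.

End InteriorMonomial.

Section GradedPieces.
Variables (K : fieldType) (n : nat) (e : rel 'I_n).
Hypothesis e_sym : ssrbool.symmetric e.
Local Notation S := {mpoly K[n]}.
Local Notation edges := [set p : 'I_n * 'I_n | e p.1 p.2]%SET.

(** Without edges there is a cover of weight zero, and the module vanishes. *)
Lemma stanley_inequality_edgeless k : (forall i j, ~~ e i j) -> (0 < k)%N ->
  stanley_inequality (supported (newton e k) : set S) (supported (newton e k.+1)).
Proof.
move=> noedge k0; rewrite /stanley_inequality.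
have J0 f : supported (newton e k) f -> f = 0 :> S.
  move=> hf; apply: msuppnil0; case E : (msupp f) => [//|m s].
  have : (k.*2 <= wt (fun=> 0%N) m)%N.
    apply: hf => [|i j eij]; first by rewrite E mem_head.
    by rewrite (negPf (noedge i j)) in eij.
  by rewrite /wt big1 //; lia.
have D : stanley_decomposition (supported (newton e k) : set S)
    (supported (newton e k.+1)) (fun _ : 'I_0 => 0) (fun=> finset.set0).
  split=> [[]//|f /J0-> |p _ _ []//].
  exists (fun=> 0); split=> [[]//|]; rewrite big_ord0 subrr => m.
  by rewrite msupp0.
have : enat_le None (sdepth (supported (newton e k) : set S) (supported (newton e k.+1))).
  apply: (enat_supP _).1; exists 0%N, (fun=> 0), (fun=> finset.set0); split=> //.
  by rewrite /decomposition_sdepth big_ord0.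
by case: (sdepth _ _) => // _; case: (depth _ _).
Qed.

(** The monomial lies deep inside the cone spanned by the edges, where only the
    tight covers matter.  If there is a component that is not bipartite, one
    of its vertices is added, which makes the weight of the monomial odd. *)
Lemma depth_le_bip_roots x y k : e x y -> (#|edges|.*2 <= k)%N ->
  enat_le (depth (supported (newton e k) : set S) (supported (newton e k.+1)))
          (Some #|bip_roots e|).
Proof.
move=> exy hk.
pose extra : 'X_{1..n} :=
  if [pick v | component e v \notin bip_roots e] is Some v then U_(v)%MM else 0%MM.
have bE w : dcover e w -> (k.*2.+2 <= wt w (edge_monomial e x y k))%N \/
    tight e w /\ wt w (edge_monomial e x y k) = k.*2.
  move=> cw; have [tw|nt] := pselect (tight e w); [right|left].
    by rewrite edge_monomial_tight.
  exact: edge_monomial_slack.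
apply: (@depth_le_bip K n e e_sym k (edge_monomial e x y k + extra)%MM).
- by move=> w /bE; rewrite wtD; case=> [|[_]]; lia.
- move=> i j iB ij ic jc w cw; rewrite 3!wtD !wt1.
  case: (bE w cw) => [|[tw ->]]; first lia.
  have := tight_colour e_sym tw ij; rewrite ic jc => /(_ isT); lia.
- move=> j jB w cw; rewrite 2!wtD wt1.
  case: (bE w cw) => [|[tw ->]]; first lia.
  rewrite /extra; case: pickP => [v vB|/(_ j)]; last by rewrite jB.
  by rewrite wt1 !(tight_nonbip e_sym tw) //; lia.
- move=> f; have tf : tight e (side_cover e f) by move=> i j; exact: side_cover_edge.
  rewrite wtD edge_monomial_tight //.
  rewrite /extra; case: pickP => [v vB|_]; last by rewrite wt0; lia.
  by rewrite wt1 /side_cover (negPf vB); lia.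
- move=> r rB nr; rewrite mnmDE edge_monomial_isolated // => [|j]; last first.
    exact: neighbour_None.
  rewrite /extra; case: pickP => [v vB|_]; last by rewrite mnm0E.
  rewrite mnm1E; have [vr|//] := eqVneq v r.
  by rewrite vr (bip_root_comp rB) rB in vB.
Qed.

End GradedPieces.

Local Close Scope classical_set_scope.
Local Close Scope ring_scope.

Theorem corollary3p8 (K : fieldType) (n : nat) (e : rel 'I_n)
    (e_sym : ssrbool.symmetric e) (e_irr : irreflexive e) :
  exists k0 : nat, forall k : nat, k0 <= k ->
    stanley_inequality
      (integral_closure (ideal_pow (edge_ideal K e) k))
      (integral_closure (ideal_pow (edge_ideal K e) k.+1)).
Proof.
exists (#|[set p : 'I_n * 'I_n | e p.1 p.2]|.*2.+1) => k hk.
rewrite !integral_closure_edge_pow //.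
have [[x [y exy]]|noedge] := pselect (exists x y, e x y); last first.
  apply: stanley_inequality_edgeless => [i j|]; last exact: leq_ltn_trans hk.
  by apply/negP => eij; apply: noedge; exists i, j.
have := depth_le_bip_roots K e_sym exy (ltnW hk).
have := sdepth_ge_bip K e_sym k; rewrite /stanley_inequality.
by case: (depth _ _) (sdepth _ _) => [d|] [d'|] //=; lia.
Qed.
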